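(* Let the SP data $\{(d_i,n_i,c_i),i\in\mathcal I\}$ satisfy the perturbation condition and let $\Gamma$ be the associated Skorokhod map. Let $(Z,Y)$ be the solution of the SP for $X\in\mathcal C_G$, let $R=(d_1\ \cdots\ d_N)\in\mathbb R^{J\times N}$, and let $L\in\mathcal C([0,\infty):\mathbb R_+^N)$ be the unique function with $L(0)=0$ such that $Y=RL$ and, for each $i\in\mathcal I$, $L^i$ is nondecreasing and $\int_0^\infty1_{\{Z(s)\notin F_i\}}\,dL^i(s)=0$. Let $\{v_i,i\in\mathcal I\}$ be vectors in $\mathbb R^J$ with $\langle v_i,n_i\rangle=0$ for each $i\in\mathcal I$, and let $V=(v_1\ \cdots\ v_N)\in\mathbb R^{J\times N}$. Let $\zeta\in\mathcal C$ and $\psi=\zeta+VL\in\mathcal C$. Let $\varepsilon_0\in(0,\infty)$ be as in the perturbation condition for $\{v_i\}$, and for $\varepsilon\in(0,\varepsilon_0)$ let $\Gamma_\varepsilon$ denote the Skorokhod map associated with the SP $\{(d_i+\varepsilon v_i,n_i,c_i),i\in\mathcal I\}$. Given $T\in(0,\infty]$, assume that $\nabla_\psi\Gamma(X)$ exists on $[0,T)$. Then $$\lim_{\varepsilon\downarrow0}\frac{\Gamma_\varepsilon(X+\varepsilon\zeta)(t)-\Gamma(X)(t)}{\varepsilon}=\nabla_\psi\Gamma(X)(t),\qquad t\in[0,T).$$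
   Context: Notation. $\mathrm{cone}(A)$ is the set of finite nonnegative linear combinations of elements of $A$, $\mathrm{cone}(\emptyset)=\{0\}$. $\mathcal C$ is the space of continuous functions $[0,\infty)\to\mathbb R^J$, $\mathcal C_G=\{f\in\mathcal C:f(0)\in G\}$. Data. $\mathcal I=\{1,\dots,N\}$; $n_i\in\mathbb R^J$ are unit vectors, $d_i\in\mathbb R^J$ with $\langle d_i,n_i\rangle=1$, $c_i\in\mathbb R$, and $G=\bigcap_{i\in\mathcal I}\{x:\langle x,n_i\rangle\ge c_i\}$ is the closure of a nonempty convex polyhedral domain. $F_i=\{x\in\partial G:\langle x,n_i\rangle=c_i\}$; $\mathcal I(x)=\{i:x\in F_i\}$ for $x\in G$; $d(x)=\mathrm{cone}(\{d_i:i\in\mathcal I(x)\})$ for $x\in\partial G$ and $d(x)=\{0\}$ for $x\in G^\circ$. Skorokhod problem. $(Z,Y)\in\mathcal C\times\mathcal C$ solves the (extended) Skorokhod problem $\{(d_i,n_i,c_i),i\in\mathcal I\}$ for $X\in\mathcal C$ if $Y(0)\in d(Z(0))$ and for all $t\ge0$: $Z(t)=X(t)+Y(t)$; $Z(t)\in G$; $Y(t)-Y(s)\in\mathrm{cone}[\cup_{u\in(s,t]}d(Z(u))]$ for all $s\in[0,t)$. Under the linear independence condition below this coincides with the classical Skorokhod problem (in particular $Y$ has finite variation on compacts), hence it is called the SP. Set-$B$ condition: there exist $\delta>0$ and a compact, convex, symmetric set $B$ with $0\in B^\circ$ such that for every $i\in\mathcal I$: if $z\in\partial B$ and $|\langle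 z,n_i\rangle|<\delta$ then $\langle\nu,d_i\rangle=0$ for all unit vectors $\nu$ with $\langle\nu,y-z\rangle\ge0$ for all $y\in B$. Projection condition: there is $\pi:\mathbb R^J\to G$ with $\pi(x)=x$ for $x\in G$ and $\pi(x)-x\in d(\pi(x))$ for $x\notin G$. Linear independence condition: for each $x\in\partial G$, $\{d_i,i\in\mathcal I(x)\}$ is linearly independent. Under the set-$B$ and projection conditions a unique solution $(Z,Y)$ exists for each $X\in\mathcal C$, and the Skorokhod map is $\Gamma(X):=Z$. Perturbation condition on $\{(d_i,n_i,c_i),i\in\mathcal I\}$: given vectors $\{v_i,i\in\mathcal I\}$ with $\langle v_i,n_i\rangle=0$ for each $i$, there is $\varepsilon_0\in(0,\infty)$ such that for each $\varepsilon\in[0,\varepsilon_0)$ the SP $\{(d_i+\varepsilon v_i,n_i,c_i),i\in\mathcal I\}$ satisfies the set-$B$ condition, the projection condition and the linear independence condition (with $d_i+\varepsilon v_i$ in place of $d_i$). Directional derivative: $\nabla_\psi\Gamma(X)(t):=\lim_{\varepsilon\downarrow0}\varepsilon^{-1}[\Gamma(X+\varepsilon\psi)(t)-\Gamma(X)(t)]$; it exists on $[0,T)$ if the limit exists for all $t\in[0,T)$. *)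

(* Defs.v *)
From HB Require Import structures.
From mathcomp Require Import all_boot all_order all_algebra.
From mathcomp Require Import all_classical all_reals all_analysis.

Set Implicit Arguments.
Unset Strict Implicit.
Unset Printing Implicit Defensive.

Import Order.TTheory GRing.Theory Num.Theory.
Import numFieldNormedType.Exports.

Local Open Scope classical_set_scope.
Local Open Scope ring_scope.

Section Euclidean.
Context {R : realType} {J : nat}.
Implicit Types (x y : 'cV[R]_J) (A : set 'cV[R]_J).

Definition dotv x y : R := (x^T *m y) 0 0.

(* The library norm on matrices is the sup norm; "unit vector" refers to the
   Euclidean norm. *)
Definition euclid_norm x : R := Num.sqrt (dotv x x).
Definition unit_vector x : Prop := euclid_norm x = 1.

Definition boundary A : set 'cV[R]_J := closure A `\` interior A.

(* Finite nonnegative combinations; the empty combination (k = 0) is allowed,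
   so that [cone set0 = [set 0]]. *)
Definition cone A : set 'cV[R]_J :=
  [set x | exists (k : nat) (a : 'I_k -> R) (y : 'I_k -> 'cV[R]_J),
     [/\ forall j, 0 <= a j, forall j, A (y j)
       & x = \sum_(j < k) a j *: y j]].

Definition symmetric_set A : Prop := forall x, A x -> A (- x).

(* Paths indexed by [0, oo) are total functions on R whose values at negative
   times are irrelevant. *)
Definition cont_path (f : R -> 'cV[R]_J) : Prop :=
  {within `[0, +oo[, continuous f}.

End Euclidean.

Definition matrix_of_cols {R : realType} {J N : nat}
  (w : 'I_N -> 'cV[R]_J) : 'M[R]_(J, N) := \matrix_(k, i) w i k 0.

Record sp_data (R : realType) (J N : nat) := SPData {
  spd : 'I_N -> 'cV[R]_J ;
  spn : 'I_N -> 'cV[R]_J ;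
  spc : 'I_N -> R }.

Section SkorokhodProblem.
Context {R : realType} {J N : nat}.
Implicit Types (D : sp_data R J N) (v : 'I_N -> 'cV[R]_J).
Implicit Types (X Y Z psi : R -> 'cV[R]_J) (x : 'cV[R]_J).

Definition polyhedron D : set 'cV[R]_J :=
  [set x | forall i, spc D i <= dotv x (spn D i)].

(* The last clause says that G is the closure of a nonempty convex domain U;
   such a U is necessarily the interior of G, hence itself polyhedral. *)
Definition sp_data_wf D : Prop :=
  [/\ forall i, unit_vector (spn D i),
      forall i, dotv (spd D i) (spn D i) = 1
    & exists U : set 'cV[R]_J,
        [/\ U !=set0, open U, convex_set U & polyhedron D = closure U]].

Definition face D (i : 'I_N) : set 'cV[R]_J :=
  [set x | boundary (polyhedron D) x /\ dotv x (spn D i) = spc D i].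

Definition active D x : set 'I_N := [set i | face D i x].

Definition dir_cone D x : set 'cV[R]_J :=
  [set w | (boundary (polyhedron D) x /\ cone (spd D @` active D x) w)
        \/ (interior (polyhedron D) x /\ w = 0)].

Definition solves_SP D X Z Y : Prop :=
  [/\ cont_path X, cont_path Z, cont_path Y,
      dir_cone D (Z 0) (Y 0)
    & forall t, 0 <= t ->
        [/\ Z t = X t + Y t,
            polyhedron D (Z t)
          & forall s, 0 <= s -> s < t ->
              cone (\bigcup_(u in `]s, t]) dir_cone D (Z u)) (Y t - Y s)]].

Definition set_B_condition D : Prop :=
  exists (delta : R) (B : set 'cV[R]_J),
    [/\ 0 < delta,
        [/\ compact B, convex_set B & symmetric_set B],
        interior B 0
      & forall i z, boundary B z -> `|dotv z (spn D i)| < delta ->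
          forall nu, unit_vector nu ->
            (forall y, B y -> 0 <= dotv nu (y - z)) ->
            dotv nu (spd D i) = 0].

Definition projection_condition D : Prop :=
  exists pi : 'cV[R]_J -> 'cV[R]_J,
    [/\ forall x, polyhedron D (pi x),
        forall x, polyhedron D x -> pi x = x
      & forall x, ~ polyhedron D x -> dir_cone D (pi x) (pi x - x)].

(* Independence of the family (d_i), i active at x: repetitions count as
   dependent. *)
Definition lin_indep_condition D : Prop :=
  forall x, boundary (polyhedron D) x ->
    free [seq spd D i | i <- enum 'I_N & `[< active D x i >]].

(* Gamma(X).  Under the set-B and projection conditions the solution exists and
   is unique on [0, oo); outside that case the value is a dummy. *)
Definition skorokhod_map D X : R -> 'cV[R]_J :=
  xget (fun=> 0) [set Z | exists Y, solves_SP D X Z Y].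

Definition perturb D v (eps : R) : sp_data R J N :=
  SPData (fun i => spd D i + eps *: v i) (spn D) (spc D).

Definition tangential D v : Prop := forall i, dotv (v i) (spn D i) = 0.

Definition perturbation_radius D v (eps0 : R) : Prop :=
  0 < eps0 /\
  forall eps, 0 <= eps -> eps < eps0 ->
    [/\ set_B_condition (perturb D v eps),
        projection_condition (perturb D v eps)
      & lin_indep_condition (perturb D v eps)].

Definition perturbation_condition D : Prop :=
  forall v, tangential D v -> exists eps0, perturbation_radius D v eps0.

(* int_0^oo 1_{Z(s) notin F_i} dL^i(s) = 0, where dL^i is the
   Lebesgue-Stieltjes measure of L^i extended by L^i(0) to negative times.
   The library measure takes a bundled nondecreasing right-continuous function
   on R, hence the quantification over [f], whose values are prescribed. *)
Definition charges_only_face D Z (L : R -> 'cV[R]_N) (i : 'I_N) : Prop :=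
  exists f : cumulative R R,
    (forall s, f s = L (Num.max 0 s) i 0) /\
    (\int[lebesgue_stieltjes_measure f]_(s in `[0%R, +oo[)
       (\1_[set u | ~ face D i (Z u)] s)%:E = 0)%E.

Definition is_pushing_process D Z Y (L : R -> 'cV[R]_N) : Prop :=
  [/\ cont_path L /\ (forall t, 0 <= t -> forall i, 0 <= L t i 0),
      L 0 = 0,
      forall t, 0 <= t -> Y t = matrix_of_cols (spd D) *m L t
    & forall i,
        (forall s t, 0 <= s -> s <= t -> L s i 0 <= L t i 0) /\
        charges_only_face D Z L i].

Definition diff_quotient (Gam : (R -> 'cV[R]_J) -> (R -> 'cV[R]_J))
    X psi (t eps : R) : 'cV[R]_J :=
  eps^-1 *: (Gam (fun s => X s + eps *: psi s) t - Gam X t).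

Definition dir_deriv Gam X psi (t : R) : 'cV[R]_J :=
  lim (diff_quotient Gam X psi t eps @[eps --> 0^'+]).

Definition dir_deriv_exists_on Gam X psi (T : \bar R) : Prop :=
  forall t, 0 <= t -> (t%:E < T)%E ->
    cvg (diff_quotient Gam X psi t eps @[eps --> 0^'+]).

End SkorokhodProblem.

(* Main.v *)
(** Let [R] and [V] have the columns [d_i] and [v_i]. If [(Ze, (R + e V) Le)]
solves the perturbed problem for [X + e zeta], then [(Ze, R Le)] solves the
unperturbed one for [X + e zeta + e V Le], whereas [Gamma (X + e psi)] has the input
[X + e zeta + e V L]. By Lipschitz continuity of [Gamma] the two outputs differ
by [O(e |Le - L|)] uniformly on [[0, t]], so that it suffices to show that
[Le - L = O(e)]. As long as [Le] stays bounded, [Ze] is close to [Z] and only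
pushes along directions active for [Z] nearby; as these are independent,
[Le - L] is recovered from [R (Le - L) = O(e)] piece by piece along a partition
of [[0, t]], and this estimate in turn keeps [Le] bounded.

Lipschitz continuity comes from the set [B]: at the first time the gauge of
[Y1 - Y2] reaches a level proportional to [sup |X1 - X2|], a subgradient of the
gauge there is nonpositive on the directions active for [Z1] and nonnegative on
those active for [Z2], so that the gauge was at least as large just before.
Solutions exist as uniform limits of the step solutions obtained by projecting
along a time grid. *)

Require Import Defs.
From HB Require Import structures.
From mathcomp Require Import all_boot all_order all_algebra.
From mathcomp Require Import all_classical all_reals all_analysis.
From mathcomp Require Import ring lra.

Set Implicit Arguments.
Unset Strict Implicit.

Import Order.TTheory GRing.Theory Num.Theory.
Import numFieldNormedType.Exports.

Local Open Scope classical_set_scope.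
Local Open Scope ring_scope.

(** * Sup-norm estimates, the Euclidean pairing and compactness *)

Section VectorNorms.
Context {R : realType}.

Lemma mx_norm_ge_entry m n (x : 'M[R]_(m, n)) i j : `|x i j| <= `|x|.
Proof.
rewrite [leRHS]/Num.norm /= mx_normrE.
exact: (le_bigmax _ (fun ij => `|x ij.1 ij.2|) (i, j)).
Qed.

Lemma mx_norm_le m n (x : 'M[R]_(m, n)) b : 0 <= b ->
  (forall i j, `|x i j| <= b) -> `|x| <= b.
Proof.
move=> b0 xb; rewrite [leLHS]/Num.norm /= mx_normrE.
by apply/bigmax_leP; split => // ij _; exact: xb.
Qed.

Lemma mx_continuous_at m n (V : normedModType R) (f : 'M[R]_(m, n) -> V) x :
  (forall e, 0 < e -> exists2 d : R, 0 < d &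
     forall y, `|x - y| < d -> `|f x - f y| < e) ->
  {for x, continuous f}.
Proof.
move=> fx; pose M := 'M[R]_(m, n) : normedModType R.
apply/(@cvgrPdist_lt _ _ _ _ (nbhs_filter (x : M))) => e /fx[d d0 fd].
by apply/(@nbhs_normP _ M); exists d.
Qed.

Lemma mulmx_norm_bound m n (A : 'M[R]_(m, n)) :
  exists2 C : R, 0 <= C & forall x : 'cV[R]_n, `|A *m x| <= C * `|x|.
Proof.
have s0 : 0 <= \sum_i \sum_j `|A i j| by do 2 apply: sumr_ge0 => ? _.
exists (\sum_i \sum_j `|A i j|) => // x.
apply: mx_norm_le => [|i j]; first by rewrite mulr_ge0.
rewrite mxE (le_trans (ler_norm_sum _ _ _)) //.
rewrite (bigD1 i) //= mulrDl ler_wpDr//.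
  by rewrite mulr_ge0 //; do 2 apply: sumr_ge0 => ? _.
rewrite mulr_suml; apply: ler_sum => k _.
by rewrite normrM ler_wpM2l // mx_norm_ge_entry.
Qed.

End VectorNorms.

Section Dot.
Context {R : realType} {J : nat}.
Implicit Types x y z g : 'cV[R]_J.

Lemma dotvE x y : dotv x y = \sum_k x k 0 * y k 0.
Proof. by rewrite /dotv mxE; apply: eq_bigr => k _; rewrite mxE. Qed.

Lemma dotvC x y : dotv x y = dotv y x.
Proof. by rewrite !dotvE; apply: eq_bigr => k _; rewrite mulrC. Qed.

Lemma dotvDl x y z : dotv (x + y) z = dotv x z + dotv y z.
Proof. by rewrite /dotv linearD /= mulmxDl mxE. Qed.

Lemma dotvNl x z : dotv (- x) z = - dotv x z.
Proof. by rewrite /dotv linearN /= mulNmx mxE. Qed.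

Lemma dotvZl a x z : dotv (a *: x) z = a * dotv x z.
Proof. by rewrite /dotv linearZ /= -scalemxAl mxE. Qed.

Lemma dotv0l z : dotv 0 z = 0.
Proof. by rewrite /dotv trmx0 mul0mx mxE. Qed.

Lemma dotvDr x y z : dotv z (x + y) = dotv z x + dotv z y.
Proof. by rewrite dotvC dotvDl !(dotvC z). Qed.

Lemma dotvNr x z : dotv z (- x) = - dotv z x.
Proof. by rewrite dotvC dotvNl dotvC. Qed.

Lemma dotvZr a x z : dotv z (a *: x) = a * dotv z x.
Proof. by rewrite dotvC dotvZl dotvC. Qed.

Lemma dotv0r z : dotv z 0 = 0.
Proof. by rewrite dotvC dotv0l. Qed.

Lemma dotv_sumr (I : finType) z (F : I -> 'cV[R]_J) :
  dotv z (\sum_i F i) = \sum_i dotv z (F i).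
Proof. by rewrite /dotv mulmx_sumr summxE. Qed.

Lemma dotv_ge0 x : 0 <= dotv x x.
Proof. by rewrite dotvE; apply: sumr_ge0 => k _; rewrite -expr2 sqr_ge0. Qed.

Lemma dotv_eq0 x : dotv x x = 0 -> x = 0.
Proof.
rewrite dotvE => /eqP; rewrite psumr_eq0; last first.
  by move=> k _; rewrite -expr2 sqr_ge0.
move=> /allP xx0; apply/colP => k; rewrite mxE; apply/eqP.
by rewrite -sqrf_eq0 expr2; apply: xx0; rewrite mem_index_enum.
Qed.

Lemma dotv_norm_bound : exists2 C : R, 0 < C &
  forall x y, `|dotv x y| <= C * `|x| * `|y|.
Proof.
exists J.+1%:R => [|x y]; first by rewrite ltr0n.
rewrite dotvE (le_trans (ler_norm_sum _ _ _)) //.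
apply: (@le_trans _ _ (\sum_(k < J) `|x| * `|y|)).
  apply: ler_sum => k _; rewrite normrM.
  by apply: ler_pM => //; exact: mx_norm_ge_entry.
rewrite sumr_const card_ord -mulrA -[leLHS]mulr_natl ler_wpM2r ?ler_nat //.
Qed.

Lemma continuous_dotvr g : continuous (fun x : 'cV[R]_J => dotv x g).
Proof.
have [C C0 Cb] := dotv_norm_bound.
move=> x; apply: mx_continuous_at => e e0.
exists (e / (C * (`|g| + 1))); first by rewrite divr_gt0 // mulr_gt0 // ltr_wpDl.
move=> y /=; rewrite -dotvNl -dotvDl => xy; rewrite (le_lt_trans (Cb _ _)) //.
move: xy; rewrite ltr_pdivlMr ?mulr_gt0 ?ltr_wpDl // => /(le_lt_trans _); apply.
by rewrite [leRHS]mulrCA [leRHS]mulrA ler_wpM2l ?mulr_ge0 ?(ltW C0) // lerDl.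
Qed.

Lemma continuous_dotv_sub z :
  continuous (fun x : 'cV[R]_J => dotv (x - z) (x - z)).
Proof.
rewrite (_ : (fun _ => _) =
  fun x => \sum_k (x k 0 - z k 0) * (x k 0 - z k 0)); last first.
  by apply/funext => x; rewrite dotvE; apply: eq_bigr => k _; rewrite !mxE.
apply: continuous_big => [|k _ x]; first exact: add_continuous.
have c : {for x, continuous (fun y : 'cV[R]_J => y k 0 - z k 0)}.
  apply: (@continuousB _ R^o); first exact: coord_continuous.
  exact: cst_continuous.
exact: (@continuousM _ _ _ _ x c c).
Qed.

(** Heine-Borel for row vectors, transported along transposition, which is continuous for the sup
    norm and undone by transposing again. *)
Lemma compact_cV (A : set 'cV[R]_J) : bounded_set A -> closed A -> compact A.
Proof.
move=> bA cA.
have trc m n : continuous (fun x : 'M[R]_(m, n) => x^T).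
  move=> x; apply: mx_continuous_at => e e0; exists e => // y.
  rewrite -linearB /= => xy.
  apply: le_lt_trans xy; apply: mx_norm_le => // i j.
  by rewrite mxE mx_norm_ge_entry.
pose A' : set 'rV[R]_J := [set y | A y^T].
have -> : A = (fun y : 'rV[R]_J => y^T) @` A'.
  apply/seteqP; split => [x Ax|x [y Ay <-]//].
  by exists x^T; rewrite /A' /= trmxK.
apply: continuous_compact.
  by apply: continuous_subspaceT => x; exact: trc.
apply: bounded_closed_compact.
  have [M [Mr Mb]] := bA; exists M; split => // b Mltb y Ay.
  have yb : `|y^T| <= b := Mb _ Mltb _ Ay.
  apply: mx_norm_le => [|i j]; first exact: le_trans yb.
  have -> : y i j = y^T j i by rewrite mxE.
  exact: le_trans (mx_norm_ge_entry _ _ _) yb.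
by apply: (@preimage_closed _ _ (fun y : 'rV[R]_J => y^T) A) => // x _; exact: trc.
Qed.

End Dot.

Lemma convex_setP {R : realType} {J : nat} (A : set 'cV[R]_J) :
  convex_set A -> forall x y (k : R), A x -> A y -> 0 <= k -> k <= 1 ->
  A (y + k *: (x - y)).
Proof.
move=> cA x y k Ax Ay k0 k1.
have := cA x y (Itv01 k0 k1); rewrite !inE => /(_ Ax Ay).
rewrite /conv /=.
suff -> : y + k *: (x - y) = k *: x + (1 - k) *: y by [].
by rewrite scalerBr scalerBl scale1r addrC addrAC addrA.
Qed.

(** * Separation, polars and the gauge of a convex body *)

Section Polar.
Context {R : realType} {J : nat}.
Variable B : set 'cV[R]_J.
Hypotheses (cB : compact B) (xB : convex_set B) (B0 : interior B 0).
Implicit Types x y z w g h : 'cV[R]_J.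

Let B00 : B 0. Proof. exact: interior_subset. Qed.

(** A point [y0] of [B] nearest to [z] in the Euclidean distance provides the normal [z - y0]: were
    its pairing with [y - y0] positive for some [y] in [B], a short move from [y0] towards [y] would
    come closer to [z]. *)
Lemma separation z : ~ B z ->
  exists g, exists2 c, forall y, B y -> dotv g y <= c & c < dotv g z.
Proof.
move=> nBz.
have [|y0 By0 ymin] := @compact_EVT_min _ R (fun x => dotv (x - z) (x - z)) B
    _ cB (continuous_subspaceT (@continuous_dotv_sub R J z)).
  by exists 0.
rewrite inE in By0.
exists (z - y0), (dotv (z - y0) y0) => [y By|]; last first.
  rewrite -subr_gt0 -dotvNr -dotvDr lt_neqAle dotv_ge0 andbT eq_sym.
  apply/eqP => /dotv_eq0 /eqP; rewrite subr_eq0 => /eqP zy0.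
  by apply: nBz; rewrite zy0.
rewrite -subr_le0 -dotvNr -dotvDr leNgt; apply/negP.
set a := dotv _ _ => a0.
pose q := dotv (y - y0) (y - y0).
have q0 : 0 <= q by exact: dotv_ge0.
(* Small enough for [t * q <= a], so that the squared distance changes by [t * (t * q - 2 * a) < 0];
   the summand 1 covers [q = 0]. *)
pose t := Num.min 1 (a / (q + 1)).
have t0 : 0 < t by rewrite lt_min ltr01 divr_gt0 // ltr_wpDl.
have t1 : t <= 1 by rewrite ge_min lexx.
have tq : t * q <= a.
  apply: (@le_trans _ _ (a / (q + 1) * q)).
    by rewrite ler_wpM2r // ge_min lexx orbT.
  by rewrite mulrAC ler_pdivrMr ?ltr_wpDl // ler_wpM2l ?(ltW a0) // lerDl.
have := ymin (y0 + t *: (y - y0)); rewrite inE => /(_ (convex_setP xB By By0 (ltW t0) t1)).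
have -> : y0 + t *: (y - y0) - z = t *: (y - y0) - (z - y0).
  by rewrite opprB addrCA addrA.
have -> : y0 - z = - (z - y0) by rewrite opprB.
rewrite -/a in a0 tq *.
have -> : dotv (t *: (y - y0) - (z - y0)) (t *: (y - y0) - (z - y0)) =
    t * (t * q - 2 * a) + dotv (z - y0) (z - y0).
  rewrite /a /q; move: (y - y0) (z - y0) => w g.
  rewrite !(dotvDl, dotvDr, dotvNl, dotvNr, dotvZl, dotvZr) (dotvC w g); ring.
by rewrite dotvNl dotvNr opprK lerDr pmulr_rge0 // => ?; lra.
Qed.

Definition polar : set 'cV[R]_J := [set g | forall y, B y -> dotv g y <= 1].

Lemma polar0 : polar 0.
Proof. by move=> y _; rewrite dotv0l. Qed.

(** [B] contains a ball around 0, and pairing with multiples of the basis vectors of either sign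
    inside that ball bounds every coordinate of a polar element. *)
Lemma polar_bound : exists2 M : R, 0 < M & forall g, polar g -> `|g| <= M.
Proof.
have /nbhs_normP[r /= r0 rB] := B0.
have r20 : 0 < r / 2 by rewrite divr_gt0.
exists (r / 2)^-1 => [|g pg]; first by rewrite invr_gt0.
apply: mx_norm_le => [|k j]; first by rewrite invr_ge0 ltW.
rewrite (ord1 j) {j}.
have dk (s : R) : dotv g (s *: delta_mx k 0) = s * g k 0.
  rewrite dotvZr dotvE (bigD1 k) //= mxE !eqxx mulr1 big1 ?addr0 // => l lk.
  by rewrite mxE (negbTE lk) mulr0.
have Bk (s : R) : `|s| = r / 2 -> s * g k 0 <= 1.
  move=> sr; rewrite -dk; apply: pg; apply: rB => /=.
  rewrite sub0r normrN normrZ sr.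
  apply: (@le_lt_trans _ _ (r / 2)); last by lra.
  rewrite ler_piMr ?(ltW r20) //; apply: mx_norm_le => // i j.
  by rewrite mxE; case: (_ && _); rewrite ?normr1 ?normr0.
rewrite -[leRHS]mul1r ler_pdivlMr // mulrC.
have := Bk (r / 2); have := Bk (- (r / 2)).
rewrite normrN gtr0_norm // => /(_ erefl) h1 /(_ erefl) h2.
by rewrite -[r / 2]gtr0_norm // -normrM ler_norml; apply/andP; split; lra.
Qed.

Lemma polar_compact : compact polar.
Proof.
apply: compact_cV.
  have [M M0 Mb] := polar_bound.
  exists M; split => [|b Mb' g pg]; first exact: num_real.
  exact: le_trans (Mb _ pg) (ltW Mb').
have -> : polar = \bigcap_(y in B) [set g | dotv g y <= 1] by [].
apply: closed_bigI => y _.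
apply: (@preimage_closed _ _ (fun g => dotv g y) [set x | x <= 1]).
  by move=> g _; exact: continuous_dotvr.
exact: closed_le.
Qed.

Lemma polar_maximizer w :
  exists2 g, polar g & forall h, polar h -> dotv h w <= dotv g w.
Proof.
have [|g] := @compact_EVT_max _ R (fun x => dotv x w) polar _ polar_compact
    (continuous_subspaceT (@continuous_dotvr R J w)).
  by exists 0; exact: polar0.
rewrite inE => pg gmax; exists g => // h ph; apply: gmax; by rewrite inE.
Qed.

(* By the bipolar theorem this is the Minkowski functional of [B]; defining it
   as the support function of the polar makes subgradients available. *)
Definition gauge w : R := sup [set dotv g w | g in polar].

Lemma gauge_attained w : exists2 g, polar g & dotv g w = gauge w.
Proof.
have [g pg gmax] := polar_maximizer w; exists g => //.
apply/eqP; rewrite eq_le; apply/andP; split.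
  apply: ub_le_sup; last by exists g.
  by exists (dotv g w) => _ [h ph <-]; exact: gmax.
apply: ge_sup => [|_ [h ph <-]]; last exact: gmax.
by exists (dotv g w); exists g.
Qed.

Lemma gauge_ge g w : polar g -> dotv g w <= gauge w.
Proof.
move=> pg; have [h ph hmax] := polar_maximizer w.
apply: ub_le_sup; last by exists g.
by exists (dotv h w) => _ [k pk <-]; exact: hmax.
Qed.

Lemma gauge_ge0 w : 0 <= gauge w.
Proof. by rewrite -(dotv0l w) gauge_ge //; exact: polar0. Qed.

(** As [B] is bounded by [M'], the basis vectors divided by [M'], with either sign, lie in the
    polar, so that the gauge dominates every coordinate. *)
Lemma gauge_norm_ge : exists2 c : R, 0 < c & forall w, c * `|w| <= gauge w.
Proof.
have [M [_ MB]] := compact_bounded cB.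
pose M' := `|M| + 1.
have M'0 : 0 < M' by rewrite ltr_wpDl.
have MB' y : B y -> `|y| <= M'.
  by move=> By; apply: MB => //; rewrite (le_lt_trans (ler_norm M)) // ltrDl.
exists M'^-1 => [|w]; first by rewrite invr_gt0.
rewrite mulrC ler_pdivrMr //.
apply: mx_norm_le => [|k j]; first by rewrite mulr_ge0 ?gauge_ge0 // ltW.
rewrite (ord1 j) {j}.
have dk (s : R) y : dotv (s *: delta_mx k 0) y = s * y k 0.
  rewrite dotvZl dotvE (bigD1 k) //= mxE !eqxx mul1r big1 ?addr0 // => l lk.
  by rewrite mxE (negbTE lk) mul0r.
have pk (s : R) : `|s| = M'^-1 -> polar (s *: delta_mx k 0).
  move=> sM y /MB' yM; rewrite dk (le_trans (ler_norm _)) // normrM sM mulrC.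
  by rewrite ler_pdivrMr // mul1r (le_trans _ yM) // mx_norm_ge_entry.
rewrite -ler_pdivrMr //.
have i0 : 0 < M'^-1 by rewrite invr_gt0.
have := gauge_ge w (pk M'^-1 (gtr0_norm i0)).
have := gauge_ge w (pk (- M'^-1) _); rewrite normrN gtr0_norm // => /(_ erefl).
rewrite !dk => h1 h2; rewrite -[M'^-1]gtr0_norm // -normrM ler_norml.
by apply/andP; split; lra.
Qed.

Lemma gauge_norm_le : exists2 C : R, 0 < C & forall w, gauge w <= C * `|w|.
Proof.
have [M M0 Mb] := polar_bound; have [C C0 Cb] := @dotv_norm_bound R J.
exists (C * M) => [|w]; first exact: mulr_gt0.
have [g pg <-] := gauge_attained w.
rewrite (le_trans (ler_norm _)) // (le_trans (Cb _ _)) //.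
by rewrite ler_wpM2r // ler_wpM2l ?(ltW C0) // Mb.
Qed.

Lemma gaugeD v w : gauge (v + w) <= gauge v + gauge w.
Proof.
have [g pg <-] := gauge_attained (v + w).
by rewrite dotvDr lerD // gauge_ge.
Qed.

(** The nontrivial half of the bipolar theorem: a functional separating [w] from [B], suitably
    rescaled, lies in the polar and exceeds 1 at [w]. *)
Lemma gauge_le1 w : gauge w <= 1 -> B w.
Proof.
move=> w1; apply: contrapT => /separation[g [c gB cw]].
have c0 : 0 <= c by rewrite -(dotv0r g) gB.
(* Unlike [c], which may be 0, the midpoint is positive and can serve as a divisor. *)
pose m := (c + dotv g w) / 2.
have cm : c < m by rewrite /m; lra.
have m0 : 0 < m by exact: le_lt_trans cm.
have pg : polar (m^-1 *: g).
  move=> y By; rewrite dotvZl mulrC ler_pdivrMr // mul1r.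
  exact: le_trans (gB _ By) (ltW cm).
have := le_trans (gauge_ge w pg) w1.
by rewrite dotvZl mulrC ler_pdivrMr // mul1r; rewrite /m; lra.
Qed.

(** A polar element attaining the gauge is an outward normal of [B] at the radial projection of [w]:
    it equals 1 there and exceeds 1 slightly farther out on the ray. This makes the set-B condition
    applicable to subgradients. *)
Lemma gauge_boundary g w :
  polar g -> 0 < gauge w -> dotv g w = gauge w ->
  boundary B ((gauge w)^-1 *: w) /\
  forall y, B y -> dotv g (y - (gauge w)^-1 *: w) <= 0.
Proof.
move=> pg p0 gw; set z := (gauge w)^-1 *: w.
have gz : dotv g z = 1 by rewrite /z dotvZr gw mulVf // gt_eqF.
have Bz : B z.
  apply: gauge_le1; have [h ph <-] := gauge_attained z.
  by rewrite /z dotvZr mulrC ler_pdivrMr // mul1r gauge_ge.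
split; last first.
  by move=> y By; rewrite dotvDr dotvNr gz subr_le0; exact: pg.
split; first exact: subset_closure.
move=> /nbhs_normP[r /= r0 rB].
pose s := r / 2 / (`|z| + 1).
have z1 : 0 < `|z| + 1 by rewrite ltr_wpDl.
have s0 : 0 < s by rewrite /s !divr_gt0.
have : B (z + s *: z).
  apply: rB => /=; rewrite opprD addrA subrr sub0r normrN normrZ gtr0_norm //.
  rewrite /s mulrAC ltr_pdivrMr //.
  rewrite mulrDr; have := normr_ge0 z; nra.
by move=> /pg; rewrite dotvDr (dotvZr s) gz; lra.
Qed.

End Polar.

(** At the infimum [u] of the failures the first hypothesis gives [P u], and the second keeps
    failures away from [u]. The start is part of the first hypothesis, whose premise is void at
    [t = 0]. *)
Lemma real_induction {R : realType} (P : R -> Prop) :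
  (forall t, 0 <= t -> (forall s, 0 <= s -> s < t -> P s) -> P t) ->
  (forall t, 0 <= t -> P t ->
     exists2 r : R, 0 < r & forall s, t < s -> s < t + r -> P s) ->
  forall t, 0 <= t -> P t.
Proof.
move=> Pl Pr t t0; apply: contrapT => nPt.
pose E := [set s | 0 <= s /\ ~ P s].
have Et : E t by [].
have lE : has_lbound E by exists 0 => s [].
have iE : has_inf E by split => //; exists t.
pose u := inf E.
have u0 : 0 <= u by apply: lb_le_inf; [exists t|move=> s []].
have Pu : P u.
  apply: Pl => // s s0 su; apply: contrapT => nPs.
  by move: su; rewrite ltNge => /negP; apply; exact: ge_inf.
have [r r0 rP] := Pr _ u0 Pu.
have [s [s0 nPs] sur] := inf_adherent r0 iE.
have [us|su|us] := ltgtP u s; [by apply: nPs; exact: rP| |by apply: nPs; rewrite -us].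
by move: su; rewrite ltNge => /negP; case; exact: (ge_inf lE (conj s0 nPs)).
Qed.

(** * Cones of reflection directions *)

Section Cones.
Context {R : realType} {J N : nat}.
Variable D : sp_data R J N.
Implicit Types (A : set 'I_N) (x w : 'cV[R]_J).

Definition refl_mx : 'M[R]_(J, N) := matrix_of_cols (spd D).

Lemma matrix_of_colsE (f : 'I_N -> 'cV[R]_J) (a : 'cV[R]_N) :
  matrix_of_cols f *m a = \sum_i a i 0 *: f i.
Proof.
apply/colP => k; rewrite mxE summxE; apply: eq_bigr => i _.
by rewrite !mxE mulrC.
Qed.

(** The coefficients form one vector indexed by all faces, so that they can be added and compared
    across different active sets. *)
Definition pos_comb A : set 'cV[R]_J :=
  [set w | exists a : 'cV[R]_N, [/\ forall i, 0 <= a i 0,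
     forall i, a i 0 != 0 -> A i & w = refl_mx *m a]].

Lemma pos_comb0 A : pos_comb A 0.
Proof. by exists 0; split => [i|i|]; rewrite ?mxE ?eqxx ?mulmx0. Qed.

Lemma pos_combD A w1 w2 : pos_comb A w1 -> pos_comb A w2 -> pos_comb A (w1 + w2).
Proof.
move=> [a [a0 aA ->]] [b [b0 bA ->]]; exists (a + b); split => [i|i|].
- by rewrite mxE addr_ge0.
- rewrite mxE; have [ai|ai _] := eqVneq (a i 0) 0; last exact: aA.
  by rewrite ai add0r; exact: bA.
- by rewrite mulmxDr.
Qed.

Lemma pos_combZ A k w : 0 <= k -> pos_comb A w -> pos_comb A (k *: w).
Proof.
move=> k0 [a [a0 aA ->]]; exists (k *: a); split => [i|i|].
- by rewrite mxE mulr_ge0.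
- by rewrite mxE mulf_eq0 negb_or => /andP[_]; exact: aA.
- by rewrite scalemxAr.
Qed.

Lemma pos_comb_sum A k (f : 'I_k -> 'cV[R]_J) :
  (forall j, pos_comb A (f j)) -> pos_comb A (\sum_j f j).
Proof.
by move=> fA; apply: big_ind => //; [exact: pos_comb0|exact: pos_combD].
Qed.

Lemma pos_combS A A' w : A `<=` A' -> pos_comb A w -> pos_comb A' w.
Proof. by move=> AA' [a [a0 aA ->]]; exists a; split => // i /aA/AA'. Qed.

Lemma cone_pos_comb A (S : set 'cV[R]_J) w :
  S `<=` pos_comb A -> cone S w -> pos_comb A w.
Proof.
move=> SA [k [a [y [a0 yS ->]]]]; apply: pos_comb_sum => j.
by apply: pos_combZ => //; exact: SA.
Qed.

Lemma pos_comb_gen A i : A i -> pos_comb A (spd D i).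
Proof.
move=> Ai; exists (delta_mx i 0); split => [j|j|].
- by rewrite mxE; case: (_ && _).
- by rewrite mxE eqxx andbT; have [->|_] := eqVneq j i; rewrite ?eqxx.
- rewrite matrix_of_colsE (bigD1 i) //= mxE !eqxx scale1r big1 ?addr0 // => j ji.
  by rewrite mxE (negbTE ji) scale0r.
Qed.

Lemma pos_comb_cone A (S : set 'cV[R]_J) w :
  (forall i, A i -> S (spd D i)) -> pos_comb A w -> cone S w.
Proof.
move=> AS [a [a0 aA ->]].
pose T : pred 'I_N := [pred i | a i 0 != 0].
exists #|T|, (fun j => a (enum_val j) 0), (fun j => spd D (enum_val j)).
split => [j//|j|].
  by apply: AS; apply: aA; exact: (enum_valP j).
rewrite -(big_enum_val (A := T) (fun i => a i 0 *: spd D i)).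
rewrite matrix_of_colsE (bigID (fun i => i \in T)) /= [X in _ + X]big1 ?addr0//.
by move=> i; rewrite inE negbK => /eqP ->; rewrite scale0r.
Qed.

Lemma dir_cone_pos_comb x w : dir_cone D x w -> pos_comb (active D x) w.
Proof.
case=> [[_]|[_ ->]]; last exact: pos_comb0.
by apply: cone_pos_comb => _ [i ai <-]; exact: pos_comb_gen.
Qed.

Hypothesis wfD : sp_data_wf D.

Lemma spn_sqr i : dotv (spn D i) (spn D i) = 1.
Proof.
have [/(_ i) + _ _] := wfD; rewrite /unit_vector /euclid_norm => n1.
by rewrite -(sqr_sqrtr (dotv_ge0 _)) n1 expr1n.
Qed.

Lemma spdn i : dotv (spd D i) (spn D i) = 1.
Proof. by have [_ + _] := wfD; exact. Qed.

(** Equality in constraint [i] forces a boundary point, since an arbitrarily short step against the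
    normal [n_i] leaves the polyhedron. *)
Lemma activeP x i : polyhedron D x ->
  active D x i <-> dotv x (spn D i) = spc D i.
Proof.
move=> Gx; split => [[]//|xi]; split => //; split; first exact: subset_closure.
move=> /nbhs_normP[r /= r0 rG].
pose s := r / 2 / (`|spn D i| + 1).
have n1 : 0 < `|spn D i| + 1 by rewrite ltr_wpDl.
have s0 : 0 < s by rewrite /s !divr_gt0.
have /(_ i) : polyhedron D (x - s *: spn D i).
  apply: rG => /=; rewrite opprD addrA subrr sub0r opprK normrZ gtr0_norm //.
  rewrite /s mulrAC ltr_pdivrMr //.
  rewrite mulrDr; have := normr_ge0 (spn D i); nra.
by rewrite dotvDl dotvNl dotvZl spn_sqr xi; lra.
Qed.

Lemma pos_comb_dir_cone x w :
  polyhedron D x -> pos_comb (active D x) w -> dir_cone D x w.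
Proof.
move=> Gx aw; have [ix|nix] := pselect (interior (polyhedron D) x).
  right; split => //; have [a [_ aA ->]] := aw.
  suff -> : a = 0 by rewrite mulmx0.
  apply/colP => i; rewrite mxE; apply/eqP/negPn/negP => /aA [[_ nix] _].
  exact: nix.
left; split; first by split => //; exact: subset_closure.
by apply: pos_comb_cone aw => i ai; exists i.
Qed.

End Cones.

(** * Lipschitz continuity from the set-B condition *)

Section Lipschitz.
Context {R : realType} {J N : nat}.
Variable D : sp_data R J N.
Hypothesis wfD : sp_data_wf D.

(* One-sided regularity and left-local cone condition: weak enough to hold both
   for continuous solutions and for right-continuous step solutions. *)
Definition gen_sol (X Y : R -> 'cV[R]_J) : Prop :=
  [/\ forall t : R, 0 <= t -> polyhedron D (X t + Y t),
      pos_comb D (active D (X 0 + Y 0)) (Y 0),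
      forall t : R, 0 < t -> exists2 r : R, 0 < r & forall s : R, 0 <= s -> t - r < s ->
        s < t -> pos_comb D (active D (X t + Y t)) (Y t - Y s)
    & forall t e : R, 0 <= t -> 0 < e -> exists2 r : R, 0 < r &
        forall s, t < s -> s < t + r -> `|Y s - Y t| < e].

Section Barrier.
Variables (delta : R) (B : set 'cV[R]_J).
Hypotheses (delta0 : 0 < delta) (cB : compact B) (xB : convex_set B)
  (B0 : interior B 0).
Hypothesis BP : forall i z, boundary B z -> `|dotv z (spn D i)| < delta ->
  forall nu, unit_vector nu -> (forall y, B y -> 0 <= dotv nu (y - z)) ->
  dotv nu (spd D i) = 0.

(** The set-B condition is applied at [w] divided by its gauge, with the inward unit normal obtained
    by normalising [- g]; the threshold [delta] scales accordingly. *)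
Lemma subgradient_orth i w g : `|dotv w (spn D i)| < delta * gauge B w ->
  polar B g -> dotv g w = gauge B w -> dotv g (spd D i) = 0.
Proof.
move=> wn pg gw.
have p0 : 0 < gauge B w.
  by rewrite -(pmulr_rgt0 _ delta0); exact: le_lt_trans wn.
have [bz gz] := gauge_boundary cB xB B0 pg p0 gw.
have gg : 0 < dotv g g.
  rewrite lt_neqAle dotv_ge0 andbT eq_sym; apply/eqP => /dotv_eq0 g0.
  by move: p0; rewrite -gw g0 dotv0l ltxx.
pose m := Num.sqrt (dotv g g).
have m0 : 0 < m by rewrite sqrtr_gt0.
have /(BP bz) : `|dotv ((gauge B w)^-1 *: w) (spn D i)| < delta.
  by rewrite dotvZl normrM gtr0_norm ?invr_gt0 // mulrC ltr_pdivrMr.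
move=> /(_ (- (m^-1 *: g))).
rewrite dotvNl dotvZl => h; have /eqP : - (m^-1 * dotv g (spd D i)) = 0.
  apply: h => [|y By].
    rewrite /unit_vector /euclid_norm dotvNl dotvNr opprK dotvZl dotvZr.
    rewrite -[dotv g g](sqr_sqrtr (dotv_ge0 _)) -/m.
    have -> : m^-1 * (m^-1 * m ^+ 2) = 1 by field; rewrite gt_eqF.
    by rewrite sqrtr1.
  by rewrite dotvNl dotvZl oppr_ge0 pmulr_rle0 ?invr_gt0 // gz.
by rewrite oppr_eq0 mulf_eq0 invr_eq0 gt_eqF //= => /eqP.
Qed.

(** A subgradient at [y] annihilates [d_i], hence keeps the value [gauge B y] along the whole line
    through [y] in this direction and bounds the gauge there from below. *)
Lemma gauge_tangent i y s : dotv y (spn D i) = 0 ->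
  gauge B y <= gauge B (y + s *: spd D i).
Proof.
move=> yn; have := gauge_ge0 B0 y; rewrite le_eqVlt => /predU1P[<-|p0].
  exact: gauge_ge0.
have [g pg gy] := gauge_attained B0 y.
have gd : dotv g (spd D i) = 0.
  by apply: (subgradient_orth _ pg gy); rewrite yn normr0 mulr_gt0.
rewrite -gy (_ : dotv g y = dotv g (y + s *: spd D i)).
  exact: gauge_ge.
by rewrite dotvDr dotvZr gd mulr0 addr0.
Qed.

(** Let [y] be the projection of [z] along [d_i] onto the hyperplane orthogonal to [n_i]. Since
    [dotv g y <= gauge B y <= gauge B z], the product of [dotv z n_i] and [dotv g d_i] is
    nonnegative; below the threshold the second factor vanishes. *)
Lemma subgradient_sign i z g a : 0 < a -> a <= gauge B z ->
  polar B g -> dotv g z = gauge B z ->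
  (dotv z (spn D i) < delta * a -> dotv g (spd D i) <= 0) /\
  (- (delta * a) < dotv z (spn D i) -> 0 <= dotv g (spd D i)).
Proof.
move=> a0 az pg gz.
have da : delta * a <= delta * gauge B z by rewrite ler_wpM2l // ltW.
have [zn|] := ltP `|dotv z (spn D i)| (delta * a).
  by rewrite (@subgradient_orth i z) // (lt_le_trans zn).
set s := dotv z (spn D i) => sa.
pose y := z - s *: spd D i.
have yn : dotv y (spn D i) = 0.
  by rewrite dotvDl dotvNl dotvZl spdn // mulr1 subrr.
have yz : gauge B y <= gauge B z.
  by rewrite (le_trans (gauge_tangent s yn)) // /y subrK.
have := gauge_ge B0 y pg.
rewrite /y dotvDr dotvNr dotvZr gz -/y => h.
have sg : 0 <= s * dotv g (spd D i) by lra.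
have d0 : 0 < delta * a by exact: mulr_gt0.
move: sa; rewrite ler_normr => /orP[] sa; split => // hs; try lra.
- by rewrite -(pmulr_rge0 _ (lt_le_trans d0 sa)).
- by rewrite -oppr_ge0 -(pmulr_rge0 _ (lt_le_trans d0 sa)) mulrNN.
Qed.

(** If [x1 + y1] lies on face [i] and [x2 + y2] in [G], then [dotv (y1 - y2) n_i] is at most
    [dotv (x2 - x1) n_i], which is less than [delta * a], so that a subgradient at [y1 - y2] is
    nonpositive on [d_i]. Exchanging the roles gives nonnegativity on the directions of [w2].
    Undoing both pushes thus cannot lower the gauge. *)
Lemma gauge_barrier (x1 x2 y1 y2 w1 w2 : 'cV[R]_J) a : 0 < a ->
  (forall i, `|dotv (x1 - x2) (spn D i)| < delta * a) ->
  polyhedron D (x1 + y1) -> polyhedron D (x2 + y2) ->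
  pos_comb D (active D (x1 + y1)) w1 -> pos_comb D (active D (x2 + y2)) w2 ->
  a <= gauge B (y1 - y2) ->
  gauge B (y1 - y2) <= gauge B (y1 - y2 - (w1 - w2)).
Proof.
move=> a0 x12 G1 G2 [a1 [a10 a1A ->]] [a2 [a20 a2A ->]] az.
have [g pg gz] := gauge_attained B0 (y1 - y2).
apply: le_trans (gauge_ge B0 _ pg).
rewrite dotvDr gz dotvNr dotvDr dotvNr lerDl opprB subr_ge0.
have sgn i := subgradient_sign i a0 az pg gz.
apply: (@le_trans _ _ 0); rewrite matrix_of_colsE dotv_sumr.
  apply: sumr_le0 => i _; rewrite dotvZr.
  have [->|/a1A] := eqVneq (a1 i 0) 0; first by rewrite mul0r.
  move=> /activeP -/(_ wfD G1) ai; rewrite mulr_ge0_le0 //.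
  apply: (sgn i).1; have := G2 i; have := x12 i; move: ai.
  rewrite !(dotvDl, dotvNl) ltr_norml => <- /andP[? ?] ?; lra.
apply: sumr_ge0 => i _; rewrite dotvZr.
have [->|/a2A] := eqVneq (a2 i 0) 0; first by rewrite mul0r.
move=> /activeP -/(_ wfD G2) ai; rewrite mulr_ge0 //.
apply: (sgn i).2; have := G1 i; have := x12 i; move: ai.
rewrite !(dotvDl, dotvNl) ltr_norml => <- /andP[? ?] ?; lra.
Qed.

End Barrier.

(** Real induction on [gauge B (Y1 s - Y2 s) < a]: [gauge_barrier] prevents the level from being
    reached at [t] if it was not reached before, and right continuity keeps the strict bound a
    little further. *)
Lemma skorokhod_lipschitz : set_B_condition D -> exists2 K : R, 0 < K &
  forall X1 Y1 X2 Y2 (T b : R), gen_sol X1 Y1 -> gen_sol X2 Y2 -> 0 < b ->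
    (forall s : R, 0 <= s -> s <= T -> `|X1 s - X2 s| <= b) ->
    forall s : R, 0 <= s -> s <= T -> `|Y1 s - Y2 s| <= K * b.
Proof.
move=> [delta [B [delta0 [cB xB _] B0 BP]]].
have [c c0 cg] := gauge_norm_ge cB B0.
have [M M0 Mg] := gauge_norm_le B0.
have [C C0 Cb] := @dotv_norm_bound R J.
pose n1 := 1 + \sum_i `|spn D i|.
have n10 : 0 < n1 by rewrite ltr_pwDl // sumr_ge0.
have nle i : `|spn D i| < n1.
  by rewrite /n1 (bigD1 i) //= ltr_pwDl // lerDl sumr_ge0.
(* Chosen so that the inputs differ by less than [delta * a] in every normal direction, as the
   barrier requires. *)
pose k := C * n1 / delta.
have k0 : 0 < k by rewrite !(mulr_gt0, invr_gt0).
exists (k / c) => [|X1 Y1 X2 Y2 T b [G1 I1 L1 R1] [G2 I2 L2 R2] b0 Xb].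
  by rewrite divr_gt0.
pose a := k * b.
have a0 : 0 < a by exact: mulr_gt0.
suff H : forall s, 0 <= s -> s <= T -> gauge B (Y1 s - Y2 s) < a.
  move=> s s0 sT; rewrite /= mulrAC ler_pdivlMr // mulrC.
  exact: le_trans (cg _) (ltW (H _ s0 sT)).
have Xn s i : 0 <= s -> s <= T -> `|dotv (X1 s - X2 s) (spn D i)| < delta * a.
  move=> s0 sT; rewrite (le_lt_trans (Cb _ _)) //.
  have -> : delta * a = C * b * n1 by rewrite /a /k; field; rewrite gt_eqF.
  apply: (@le_lt_trans _ _ (C * b * `|spn D i|)).
    by rewrite ler_wpM2r // ler_wpM2l ?(ltW C0) // Xb.
  by rewrite ltr_pM2l // mulr_gt0.
apply: real_induction => [t t0 IH tT|t t0 IH].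
  rewrite ltNge; apply/negP => az.
  have bar := gauge_barrier delta0 cB xB B0 BP a0 (fun i => Xn t i t0 tT) (G1 t t0) (G2 t t0).
  move: t0; rewrite le_eqVlt => /predU1P[t00|t0].
    (* At time 0 the initial pushes are undone completely, which would leave
       [a <= gauge B 0 = 0]. *)
    rewrite -t00 in bar az.
    have := bar _ _ I1 I2 az; rewrite subrr; have [g _ <-] := gauge_attained B0 0.
    rewrite dotv0r leNgt => /negP; apply; exact: lt_le_trans az.
  have [r1 r10 r1P] := L1 _ t0.
  have [r2 r20 r2P] := L2 _ t0.
  pose s := Num.max 0 (t - Num.min r1 r2 / 2).
  have m0 : 0 < Num.min r1 r2 by rewrite lt_min r10.
  have s0 : 0 <= s by rewrite le_max lexx.
  have st : s < t by rewrite gt_max t0 /=; lra.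
  have ms : t - Num.min r1 r2 < s by rewrite lt_max; apply/orP; right; lra.
  have rs1 : t - r1 < s.
    by apply: le_lt_trans ms; rewrite lerD2l lerN2 ge_min lexx.
  have rs2 : t - r2 < s.
    by apply: le_lt_trans ms; rewrite lerD2l lerN2 ge_min lexx orbT.
  have := bar _ _ (r1P _ s0 rs1 st) (r2P _ s0 rs2 st) az.
  have -> : Y1 t - Y2 t - (Y1 t - Y1 s - (Y2 t - Y2 s)) = Y1 s - Y2 s.
    by apply/matrixP => i j; rewrite !mxE; ring.
  rewrite leNgt => /negP; apply; apply: lt_le_trans az.
  by apply: IH => //; rewrite (le_trans (ltW st)).
have [tT|tT] := leP t T; last first.
  by exists 1 => // s ts _ sT; have := lt_le_trans ts sT; rewrite ltNge (ltW tT).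
have h : 0 < (a - gauge B (Y1 t - Y2 t)) / (2 * M).
  by rewrite divr_gt0 ?mulr_gt0 // subr_gt0 IH.
have [r1 r10 r1P] := R1 _ _ t0 h.
have [r2 r20 r2P] := R2 _ _ t0 h.
exists (Num.min r1 r2) => [|s ts sr sT]; first by rewrite lt_min r10.
have -> : Y1 s - Y2 s = (Y1 t - Y2 t) + ((Y1 s - Y1 t) - (Y2 s - Y2 t)).
  by apply/matrixP => i j; rewrite !mxE; ring.
rewrite (le_lt_trans (gaugeD B0 _ _)) // -ltrBrDl (le_lt_trans (Mg _)) //.
rewrite mulrC -ltr_pdivlMr // (le_lt_trans (ler_normB _ _)) //.
have s1 : s < t + r1 by apply: lt_le_trans sr _; rewrite lerD2l ge_min lexx.
have s2 : s < t + r2 by apply: lt_le_trans sr _; rewrite lerD2l ge_min lexx orbT.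
have := ltrD (r1P _ ts s1) (r2P _ ts s2).
by rewrite invfM mulrA mulrAC -splitr.
Qed.

End Lipschitz.

(** * Active faces along a continuous path and recovery of the coefficients *)

Lemma cont_pathP {R : realType} {J : nat} (f : R -> 'cV[R]_J) :
  cont_path f <-> forall t e : R, 0 <= t -> 0 < e -> exists2 r : R, 0 < r &
    forall s, 0 <= s -> `|s - t| < r -> `|f s - f t| < e.
Proof.
rewrite /cont_path; split => [/subspace_continuousP fc t e t0 e0|fc].
  have : (`[0, +oo[%classic : set R) t by rewrite /= in_itv /= t0.
  move=> /(fc t)/cvgrPdist_lt/(_ e e0).
  rewrite near_withinE => /nbhs_normP[r /= r0 rf]; exists r => // s s0 st.
  by rewrite distrC; apply: rf => /=; rewrite ?in_itv/= ?s0// distrC.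
apply/subspace_continuousP => t; rewrite /= in_itv /= andbT => t0.
apply/cvgrPdist_lt => e e0; rewrite near_withinE; apply/nbhs_normP.
have [r r0 rf] := fc t e t0 e0; exists r => // s /= st; rewrite in_itv /= andbT.
by move=> s0; rewrite distrC rf // distrC.
Qed.

Section Active.
Context {R : realType} {J N : nat}.
Variable D : sp_data R J N.
Hypothesis wfD : sp_data_wf D.
Implicit Types (X Y Z : R -> 'cV[R]_J) (x y : 'cV[R]_J).

(** A constraint inactive at [x] has positive slack, which persists nearby; being finitely many, the
    constraints share one [eta]. *)
Lemma active_near x : polyhedron D x -> exists2 eta : R, 0 < eta &
  forall y i, `|y - x| < eta -> dotv y (spn D i) < spc D i + eta ->
    active D x i.
Proof.
move=> Gx; have [C C0 Cb] := @dotv_norm_bound R J.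
have slack i : exists eta : R, 0 < eta /\
    forall y, `|y - x| < eta -> dotv y (spn D i) < spc D i + eta -> active D x i.
  have := Gx i; rewrite le_eqVlt => /predU1P[xi|xi].
    by exists 1; split => // _ _ _; apply/activeP.
  pose k := C * (`|spn D i| + 1).
  have k0 : 0 < k by rewrite mulr_gt0 // ltr_wpDl.
  exists ((dotv x (spn D i) - spc D i) / (k + 1)); split => [|y].
    by rewrite divr_gt0 ?subr_gt0 // ltr_wpDl // ltW.
  set e := _ / _ => ye yi; exfalso.
  have ek : e * (k + 1) = dotv x (spn D i) - spc D i.
    by rewrite /e divfK // gt_eqF // ltr_wpDl // ltW.
  have e0 : 0 < e by exact: le_lt_trans ye.
  have := Cb (y - x) (spn D i); rewrite dotvDl dotvNl => /ler_normlP[+ _].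
  have : C * `|y - x| * `|spn D i| <= e * k.
    rewrite /k mulrCA -mulrA ler_wpM2l ?(ltW C0) //.
    by apply: ler_pM => //; [exact: ltW|rewrite lerDl].
  lra.
have [eta etaP] := choice slack.
pose m := \big[Num.min/1]_i eta i.
have m0 : 0 < m by apply/bigmin_gtP; split => // i _; exact: (etaP i).1.
have mi i : m <= eta i by exact: bigmin_le_cond.
exists m => // y i yx yi; apply: (etaP i).2; first exact: lt_le_trans yx _.
by apply: lt_le_trans yi _; rewrite lerD2l.
Qed.

Lemma active_near_path Z t : cont_path Z -> (forall t, 0 <= t -> polyhedron D (Z t)) ->
  0 <= t -> exists eta r : R, [/\ 0 < eta, 0 < r & forall s i, 0 <= s -> `|s - t| < r ->
    dotv (Z s) (spn D i) < spc D i + eta -> active D (Z t) i].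
Proof.
move=> cZ GZ t0; have [eta eta0 etaP] := active_near (GZ t t0).
have [r r0 rP] := (cont_pathP Z).1 cZ t eta t0 eta0.
by exists eta, r; split => // s i s0 st; apply: etaP; exact: rP.
Qed.

Lemma active_lt (e : R) y i :
  0 < e -> active D y i -> dotv y (spn D i) < spc D i + e.
Proof. by move=> e0 [_ ->]; rewrite ltrDl. Qed.

Lemma solves_gen_sol X Z Y : solves_SP D X Z Y -> gen_sol D X Y.
Proof.
move=> [cX cZ cY Y0 ZP].
have ZE t : 0 <= t -> X t + Y t = Z t by move=> /ZP[->].
have GZ t : 0 <= t -> polyhedron D (Z t) by move=> /ZP[].
split.
- by move=> t t0; rewrite ZE //; exact: GZ.
- by rewrite ZE //; exact: dir_cone_pos_comb.
- move=> t t0; have [eta [r [eta0 r0 etaP]]] := active_near_path cZ GZ (ltW t0).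
  exists r => // s s0 rs st; rewrite ZE ?(ltW t0) //.
  have [_ _ /(_ s s0 st)] := ZP t (ltW t0).
  apply: cone_pos_comb => w [u /=]; rewrite in_itv /= => /andP[su ut].
  move=> /dir_cone_pos_comb; apply: pos_combS => i ai.
  apply: (etaP u); [exact: ltW (le_lt_trans s0 su)| |exact: active_lt].
  by rewrite ler0_norm ?subr_le0 //; lra.
- move=> t e t0 e0; have [r r0 rP] := (cont_pathP Y).1 cY t e t0 e0.
  exists r => // s ts sr; apply: rP; first exact: ltW (le_lt_trans t0 ts).
  by rewrite gtr0_norm ?subr_gt0 //; lra.
Qed.

(** The coefficients are read off by the coordinate functionals of the free family, and these are
    bounded because the space has finite dimension. *)
Lemma free_bound (S : seq 'I_N) : uniq S -> free [seq spd D i | i <- S] ->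
  exists2 C : R, 0 <= C & forall a : 'cV[R]_N, (forall i, a i 0 != 0 -> i \in S) ->
    `|a| <= C * `|refl_mx D *m a|.
Proof.
move=> uS; pose V := map_tuple (spd D) (in_tuple S) => fV.
have fV' : free V by [].
have lin_bound (f : {linear 'cV[R]_J -> R^o}) :
    exists2 C : R, 0 <= C & forall x, `|f x| <= C * `|x|.
  exists (\sum_k `|f (delta_mx k 0)|) => [|x]; first exact: sumr_ge0.
  rewrite {1}[x]matrix_sum_delta linear_sum mulr_suml.
  rewrite (le_trans (ler_norm_sum _ _ _)) //; apply: ler_sum => k _.
  rewrite big_ord1 linearZ /= normrM mulrC ler_wpM2l //.
  exact: mx_norm_ge_entry.
have /choice[C CP] : forall j : 'I_(size S), exists c : R, 0 <= c /\
    forall x : 'cV[R]_J, `|coord V j x| <= c * `|x|.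
  by move=> j; have [c c0 cP] := lin_bound (coord V j); exists c; split.
have s0 : 0 <= \sum_j C j by apply: sumr_ge0 => j _; exact: (CP j).1.
exists (\sum_j C j) => // a aS; apply: mx_norm_le => [|i k].
  by rewrite mulr_ge0.
rewrite (ord1 k) {k}; have [->|/aS iS] := eqVneq (a i 0) 0.
  by rewrite normr0 mulr_ge0.
have lt_i : (index i S < size S)%N by rewrite index_mem.
pose j := Ordinal lt_i.
have -> : a i 0 = coord V j (refl_mx D *m a).
  rewrite matrix_of_colsE.
  have -> : \sum_i a i 0 *: spd D i = \sum_(l < size S) a (nth i S l) 0 *: V`_l.
    transitivity (\sum_(l <- S) a l 0 *: spd D l).
      rewrite [RHS]big_uniq //= [LHS](bigID (fun l => l \in S)) /=.
      rewrite [X in _ + X]big1 ?addr0 // => l lS.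
      have [->|/aS] := eqVneq (a l 0) 0; first by rewrite scale0r.
      by rewrite (negbTE lS).
    rewrite (big_nth i) big_mkord; apply: eq_bigr => l _.
    by rewrite (nth_map i).
  by rewrite coord_sum_free //= nth_index.
apply: le_trans ((CP j).2 _) _; rewrite ler_wpM2r // (bigD1 j) //= lerDl.
by apply: sumr_ge0 => l _; exact: (CP l).1.
Qed.

(* There are only finitely many active sets, hence a single constant. *)
Lemma lin_indep_bound : lin_indep_condition D -> exists2 C : R, 0 < C &
  forall x (a : 'cV[R]_N), polyhedron D x -> (forall i, a i 0 != 0 -> active D x i) ->
    `|a| <= C * `|refl_mx D *m a|.
Proof.
move=> li.
have /choice[C CP] : forall A : {set 'I_N}, exists c : R, 0 <= c /\
    forall x (a : 'cV[R]_N), polyhedron D x -> (forall i, i \in A <-> active D x i) ->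
    (forall i, a i 0 != 0 -> active D x i) -> `|a| <= c * `|refl_mx D *m a|.
  move=> A; have [[x [Gx bx xA]]|nx] := pselect (exists x, [/\ polyhedron D x,
      boundary (polyhedron D) x & forall i, i \in A <-> active D x i]).
    have [|c c0 cP] := free_bound _ (li x bx); first exact/filter_uniq/enum_uniq.
    exists c; split => // y a Gy yA aA; apply: cP => i /aA /yA /xA ai.
    by rewrite mem_filter mem_enum andbT; apply/asboolP.
  (* A nonzero entry of [a] would make [x] a boundary point with active set [A], which is excluded
     in this case. *)
  exists 0; split => // x a Gx xA aA.
  suff -> : a = 0 by rewrite normr0 mul0r.
  apply/colP => i; rewrite mxE; apply/eqP/negPn/negP => /aA [bx _].
  by apply: nx; exists x.
have s0 : 0 <= \sum_A C A by apply: sumr_ge0 => A _; exact: (CP A).1.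
exists (1 + \sum_A C A) => [|x a Gx aA]; first by rewrite ltr_pwDl.
pose A := [set i | `[< active D x i >]]%SET.
have xA i : i \in A <-> active D x i by rewrite inE; split => /asboolP.
apply: le_trans ((CP A).2 x a Gx xA aA) _; rewrite ler_wpM2r // (bigD1 A) //=.
by rewrite addrCA lerDl addr_ge0 // sumr_ge0 // => B _; exact: (CP B).1.
Qed.

(** The sign of the increments is left open, so that differences of pushing processes qualify. The
    first clause treats [w 0] as a jump at time 0. *)
Definition supported_near Z (eta t : R) (w : R -> 'cV[R]_N) : Prop :=
  (forall i, w 0 i 0 != 0 -> dotv (Z 0) (spn D i) < spc D i + eta) /\
  (forall s r i, 0 <= s -> s < r -> r <= t -> w r i 0 != w s i 0 ->
     exists u, [/\ s < u, u <= r & dotv (Z u) (spn D i) < spc D i + eta]).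

Lemma supported_nearS Z eta eta' t t' w : eta <= eta' -> t' <= t ->
  supported_near Z eta t w -> supported_near Z eta' t' w.
Proof.
move=> ee tt [w0 wt]; split => [i /w0 /lt_le_trans|s r i s0 sr rt /(wt _ _ _ s0 sr)].
  by apply; rewrite lerD2l.
move=> /(_ (le_trans rt tt))[u [su ur ui]]; exists u; split => //.
by apply: lt_le_trans ui _; rewrite lerD2l.
Qed.

(** Real induction on [T]. Around any time only directions active for [Z] at that time carry
    increments of [w]; these directions are independent, so each increment is controlled by its
    image under the reflection matrix. *)
Lemma reflection_inverse Z T : lin_indep_condition D -> cont_path Z ->
  (forall t, 0 <= t -> polyhedron D (Z t)) -> 0 <= T ->
  exists C eta : R, [/\ 0 < C, 0 < eta & forall t w b, 0 <= t -> t <= T ->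
    supported_near Z eta t w ->
    (forall s, 0 <= s -> s <= t -> `|refl_mx D *m w s| <= b) -> `|w t| <= C * b].
Proof.
move=> li cZ GZ; have [K K0 KP] := lin_indep_bound li.
pose P T := exists C eta : R, [/\ 0 < C, 0 < eta & forall t w b, 0 <= t -> t <= T ->
    supported_near Z eta t w ->
    (forall s, 0 <= s -> s <= t -> `|refl_mx D *m w s| <= b) -> `|w t| <= C * b].
(* Extension by one piece: the increment of [w] past [s] uses only directions active at [x] and has
   an image of norm at most [2 * b], whence the additional [2 * K]. *)
have ext x s t eta0 : P s -> 0 <= s -> s < t -> polyhedron D x -> 0 < eta0 ->
    (forall u i, s < u -> u <= t -> dotv (Z u) (spn D i) < spc D i + eta0 ->
       active D x i) -> P t.
  move=> [C [eta [C0 e0 CP]]] s0 st Gx eta00 act.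
  exists (C + 2 * K), (Num.min eta eta0); split => [||r w b r0 rt sup wb].
  - by rewrite addr_gt0 // mulr_gt0.
  - by rewrite lt_min e0.
  have b0 : 0 <= b by apply: le_trans (wb 0 _ _).
  have [rs|sr] := leP r s.
    apply: (@le_trans _ _ (C * b)); last first.
      by rewrite ler_wpM2r // lerDl mulr_ge0 // ltW.
    by apply: CP => //; apply: supported_nearS sup => //; rewrite ge_min lexx.
  have -> : w r = w s + (w r - w s) by rewrite addrC subrK.
  rewrite mulrDl (le_trans (ler_normD _ _)) // lerD //.
    apply: CP => // [|u u0 us]; last by rewrite wb // (le_trans us (ltW sr)).
    by apply: supported_nearS sup; rewrite ?(ltW sr)// ge_min lexx.
  apply: le_trans (KP x _ Gx _) _ => [i|].
    rewrite !mxE subr_eq0 => wi.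
    have [u [su ur ui]] := sup.2 _ _ _ s0 sr (lexx r) wi.
    apply: (act u) => //; first exact: le_trans ur rt.
    by apply: lt_le_trans ui _; rewrite lerD2l ge_min lexx orbT.
  rewrite -mulrA mulrCA ler_wpM2l ?(ltW K0) //.
  rewrite mulmxBr (le_trans (ler_normB _ _)) // mulr_natl mulr2n lerD // wb //.
  exact: ltW.
suff : forall t, 0 <= t -> P t by apply.
apply: real_induction => t t0.
  move=> IH; have [eta [r [eta0 r0 near]]] := active_near_path cZ GZ t0.
  move: (t0); rewrite le_eqVlt => /predU1P[tE|tp].
    exists K, eta; split => // s w b s0 st sup wb.
    have -> : s = 0 by apply/eqP; rewrite eq_le s0 tE st.
    apply: le_trans (KP (Z t) _ (GZ _ t0) _) _ => [i|].
      by move=> /sup.1; apply: near; rewrite -?tE // subrr normr0.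
    by rewrite ler_wpM2l ?(ltW K0) // wb.
  pose s := Num.max 0 (t - r / 2).
  have s0 : 0 <= s by rewrite le_max lexx.
  have st : s < t by rewrite gt_max tp /=; lra.
  have rs : t - r < s by rewrite lt_max; apply/orP; right; lra.
  apply: (ext (Z t) s t eta) => //; [exact: IH|exact: GZ|].
  move=> u i su ut; apply: near; first exact: ltW (le_lt_trans s0 su).
  by rewrite ler0_norm ?subr_le0 //; lra.
move=> Pt; have [eta [r [eta0 r0 near]]] := active_near_path cZ GZ t0.
exists r => // s ts sr; apply: (ext (Z t) t s eta) => //; first exact: GZ.
move=> u i tu us; apply: near; first exact: ltW (le_lt_trans t0 tu).
by rewrite gtr0_norm ?subr_gt0 //; lra.
Qed.

End Active.

(** * Locally uniform limits and uniform continuity *)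

Section UniformLimits.
Context {R : realType} {m : nat}.

Lemma vec_cauchy (u : nat -> 'cV[R]_m) :
  (forall e : R, 0 < e -> exists n0, forall n k, (n0 <= n)%N -> (n0 <= k)%N ->
     `|u n - u k| <= e) ->
  exists l, forall e : R, 0 < e -> exists n0, forall n, (n0 <= n)%N -> `|u n - l| <= e.
Proof.
move=> cu.
have cv : cvg (u n @[n --> \oo]).
  apply: cauchy_cvg; apply: cauchy_exP => e e0.
  have [n0 n0P] := cu (e / 2) (divr_gt0 e0 (ltr0Sn _ _)).
  exists (u n0); exists n0 => // n /= n0n.
  by rewrite -ball_normE /=; apply: le_lt_trans (n0P _ _ (leqnn _) n0n) _; lra.
exists (lim (u n @[n --> \oo])) => e e0.
have [n0 _ n0P] := cvgr_dist_le _ _ cv _ e0.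
by exists n0 => n n0n; rewrite distrC; exact: n0P.
Qed.

Lemma unif_cauchy_lim (f : nat -> R -> 'cV[R]_m) :
  (forall T e : R, 0 < e -> exists n0, forall n k t, (n0 <= n)%N -> (n0 <= k)%N ->
     0 <= t -> t <= T -> `|f n t - f k t| <= e) ->
  exists g : R -> 'cV[R]_m, forall T e : R, 0 < e -> exists n0, forall n t,
    (n0 <= n)%N -> 0 <= t -> t <= T -> `|f n t - g t| <= e.
Proof.
move=> cf.
have /choice[g gP] : forall t : R, exists l, 0 <= t -> forall e : R, 0 < e ->
    exists n0, forall n, (n0 <= n)%N -> `|f n t - l| <= e.
  move=> t; have [t0|t0] := leP 0 t; last by exists 0.
  have [e e0|l lP] := @vec_cauchy (f ^~ t); last by exists l.
  by have [n0 n0P] := cf t e e0; exists n0 => n k n0n n0k; exact: n0P.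
exists g => T e e0; have [n0 n0P] := cf T e e0; exists n0 => n t n0n t0 tT.
apply/ler_addgt0Pr => d d0; have [n1 n1P] := gP t t0 d d0.
(* This index depends on [t], but the bound [e] on the distance of [f n] and [f k] does not. *)
pose k := maxn n0 n1.
rewrite (le_trans (ler_distD (f k t) _ _)) // lerD //.
  by apply: n0P => //; rewrite leq_maxl.
by apply: n1P; rewrite leq_maxr.
Qed.

Lemma unif_cont_path (X : R -> 'cV[R]_m) T e : cont_path X -> 0 <= T -> 0 < e ->
  exists2 d : R, 0 < d & forall s t, 0 <= s -> s <= t -> t <= T -> t - s < d ->
    `|X t - X s| < e.
Proof.
move=> /cont_pathP cX + e0; move: T.
pose P T := exists2 d : R, 0 < d & forall s t, 0 <= s -> s <= t -> t <= T -> t - s < d ->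
    `|X t - X s| < e.
suff : forall T, 0 <= T -> P T by [].
have e20 : 0 < e / 2 by rewrite divr_gt0.
have ext u : 0 <= u -> exists2 r : R, 0 < r & forall a b, u - r < a -> P a -> b < u + r -> P b.
  move=> u0; have [r r0 rP] := cX u _ u0 e20.
  exists r => // a b ua [d d0 dP] bu.
  (* If [a < t], the second entry forces [s] above [u - r], so that both times lie within [r] of
     [u]. *)
  exists (Num.min d (a - (u - r))); first by rewrite lt_min d0 subr_gt0.
  move=> s t s0 st tb; rewrite lt_min => /andP[tsd tsa].
  have [ta|at_] := leP t a; first exact: dP.
  rewrite (le_lt_trans (ler_distD (X u) _ _)) // [e]splitr ltrD //.
    by apply: rP; [exact: le_trans st|rewrite ltr_norml; apply/andP; split; lra].
  by rewrite distrC; apply: rP => //; rewrite ltr_norml; apply/andP; split; lra.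
apply: real_induction => t t0; have [r r0 rP] := ext t t0.
  move: (t0); rewrite le_eqVlt => /predU1P[<- _|tp IH].
    exists 1 => // s t' s0 st t'0 _; have -> : s = t'; last by rewrite subrr normr0.
    by apply/eqP; rewrite eq_le st (le_trans t'0).
  apply: (rP (Num.max 0 (t - r / 2))); last by lra.
    by rewrite lt_max; apply/orP; right; lra.
  by apply: IH; [rewrite le_max lexx|rewrite gt_max tp /=; lra].
by move=> Pt; exists r => // s ts sr; apply: (rP t) => //; lra.
Qed.

End UniformLimits.

(** * Oscillation of solutions *)

Section Oscillation.
Context {R : realType} {J N : nat}.
Variable D : sp_data R J N.
Hypothesis wfD : sp_data_wf D.

(* Restart at time [s] and compare with the constant solution. *)
Lemma skorokhod_oscillation : set_B_condition D -> exists2 K : R, 0 < K &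
  forall X Y (s t b : R), gen_sol D X Y -> 0 <= s -> s <= t -> 0 < b ->
    (forall u, s <= u -> u <= t -> `|X u - X s| <= b) -> `|Y t - Y s| <= K * b.
Proof.
move=> /(skorokhod_lipschitz wfD)[K K0 KP]; exists K => // X Y s t b [GY Y0 LY RY] s0 st b0 Xb.
pose z := X s + Y s.
have Gz : polyhedron D z by exact: GY.
have G1 : gen_sol D (fun u => X (s + u) + Y s) (fun u => Y (s + u) - Y s).
  have E u : X (s + u) + Y s + (Y (s + u) - Y s) = X (s + u) + Y (s + u).
    by apply/matrixP => i j; rewrite !mxE; ring.
  split.
  - by move=> u u0; rewrite E; apply: GY; rewrite addr_ge0.
  - by rewrite addr0 subrr; exact: pos_comb0.
  - move=> u u0; have [|r r0 rP] := LY (s + u); first by rewrite ltr_wpDl.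
    exists r => // v v0 rv vu; rewrite E.
    have -> : Y (s + u) - Y s - (Y (s + v) - Y s) = Y (s + u) - Y (s + v).
      by apply/matrixP => i j; rewrite !mxE; ring.
    by apply: rP; [rewrite addr_ge0|lra|lra].
  - move=> u e u0 e0; have [|r r0 rP] := RY (s + u) e _ e0; first by rewrite addr_ge0.
    exists r => // v uv vr; rewrite opprB addrA subrK; apply: rP; lra.
have G2 : gen_sol D (fun=> z) (fun=> 0).
  split => [u _||u u0|u e u0 e0].
  - by rewrite addr0.
  - exact: pos_comb0.
  - by exists 1 => // v _ _ _; rewrite subrr; exact: pos_comb0.
  - by exists 1 => // v _ _; rewrite subrr normr0.
have := KP _ _ _ _ (t - s) b G1 G2 b0 _ (t - s).
rewrite /= subr0 (addrC s) subrK; apply => //; last by rewrite subr_ge0.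
move=> u u0 us; have -> : X (s + u) + Y s - z = X (s + u) - X s.
  by apply/matrixP => i j; rewrite !mxE; ring.
by apply: Xb; lra.
Qed.

End Oscillation.

(** * Pushing processes *)

Section Pushing.
Context {R : realType} {J N : nat}.
Variable D : sp_data R J N.
Implicit Types (X Y Z : R -> 'cV[R]_J) (L : R -> 'cV[R]_N).

(** Complementarity without Stieltjes integrals: a component grows over a half-open interval only if
    [Z] meets the corresponding face there. A nonzero [L 0] is allowed, because a perturbed input
    may start outside [G]. *)
Definition pushes Z L : Prop :=
  [/\ forall i, 0 <= L 0 i 0,
      forall i, L 0 i 0 != 0 -> active D (Z 0) i,
      forall (s t : R) i, 0 <= s -> s <= t -> L s i 0 <= L t i 0
    & forall (s t : R) i, 0 <= s -> s < t -> L t i 0 != L s i 0 ->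
        exists u, [/\ s < u, u <= t & active D (Z u) i]].

Lemma cont_path_mulmx m n (A : 'M[R]_(m, n)) (f : R -> 'cV[R]_n) :
  cont_path f -> cont_path (fun t => A *m f t).
Proof.
move=> /cont_pathP cf; apply/cont_pathP => t e t0 e0.
have [C C0 CP] := mulmx_norm_bound A.
have C1 : 0 < C + 1 by rewrite ltr_wpDl.
have [r r0 rP] := cf t (e / (C + 1)) t0 (divr_gt0 e0 C1).
exists r => // s s0 /(rP _ s0); rewrite ltr_pdivlMr // => h.
by rewrite -mulmxBr (le_lt_trans (CP _)) //; have := normr_ge0 (f s - f t); nra.
Qed.

Lemma cont_pathD n (f g : R -> 'cV[R]_n) :
  cont_path f -> cont_path g -> cont_path (fun t => f t + g t).
Proof.
move=> /cont_pathP cf /cont_pathP cg; apply/cont_pathP => t e t0 e0.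
have e20 : 0 < e / 2 by rewrite divr_gt0.
have [r r0 rP] := cf t _ t0 e20; have [d d0 dP] := cg t _ t0 e20.
exists (Num.min r d) => [|s s0]; first by rewrite lt_min r0.
rewrite lt_min opprD addrACA => /andP[sr sd].
by rewrite (le_lt_trans (ler_normD _ _)) // [e]splitr ltrD ?rP ?dP.
Qed.

Lemma pushes_solves X Z L : sp_data_wf D -> cont_path X -> cont_path L ->
  (forall t, 0 <= t -> Z t = X t + refl_mx D *m L t) ->
  (forall t, 0 <= t -> polyhedron D (Z t)) -> pushes Z L ->
  solves_SP D X Z (fun t => refl_mx D *m L t).
Proof.
move=> wfD cX cL ZE GZ [L0 S0 Lm SL].
have cY : cont_path (fun t => refl_mx D *m L t) by exact: cont_path_mulmx.
split => //.
- have /cont_pathP cZ := cont_pathD cX cY.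
  apply/cont_pathP => t e t0 /(cZ t _ t0)[r r0 rP].
  by exists r => // s s0 st; rewrite !ZE // rP.
- by apply: pos_comb_dir_cone => //; [exact: GZ|exists (L 0)].
- move=> t t0; split; [exact: ZE|exact: GZ|move=> s s0 st].
  pose A i := exists u, [/\ s < u, u <= t & active D (Z u) i].
  apply: (@pos_comb_cone _ _ _ _ A) => [i [u [su ut ui]]|].
    exists u; first by rewrite /= in_itv /= su.
    apply: pos_comb_dir_cone => //; last exact: pos_comb_gen.
    by apply: GZ; exact: ltW (le_lt_trans s0 su).
  exists (L t - L s); split => [i|i|]; last by rewrite mulmxBr.
    by rewrite !mxE subr_ge0 Lm // ltW.
  by rewrite !mxE subr_eq0; exact: SL.
Qed.

End Pushing.

(** * Step solutions along a time grid *)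

Section Steps.
Context {R : realType} {J N : nat}.
Variable D : sp_data R J N.
Hypothesis wfD : sp_data_wf D.
Local Notation A := (refl_mx D).

Lemma projection_push : projection_condition D ->
  exists alpha : 'cV[R]_J -> 'cV[R]_N, forall x, [/\ forall i, 0 <= alpha x i 0,
    forall i, alpha x i 0 != 0 -> active D (x + A *m alpha x) i
    & polyhedron D (x + A *m alpha x)].
Proof.
move=> [pi [Gpi piG dpi]].
have /choice[alpha aP] : forall x, exists a : 'cV[R]_N, [/\ forall i, 0 <= a i 0,
    forall i, a i 0 != 0 -> active D (x + A *m a) i & polyhedron D (x + A *m a)].
  move=> x; have [Gx|nGx] := pselect (polyhedron D x).
    by exists 0; split => [i|i|]; rewrite ?mxE ?eqxx // mulmx0 addr0.
  have [a [a0 aA aE]] := dir_cone_pos_comb (dpi x nGx).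
  by exists a; rewrite -aE addrC subrK.
by exists alpha.
Qed.

Variable X : R -> 'cV[R]_J.
Variable alpha : 'cV[R]_J -> 'cV[R]_N.
Hypothesis alphaP : forall x, [/\ forall i, 0 <= alpha x i 0,
    forall i, alpha x i 0 != 0 -> active D (x + A *m alpha x) i
    & polyhedron D (x + A *m alpha x)].
Variable n : nat.

Definition grid (k : nat) : R := k%:R / n.+1%:R.

(** Coefficients rather than displacements are accumulated, so that the faces responsible for each
    push stay visible in the limit. *)
Fixpoint euler (k : nat) : 'cV[R]_N :=
  if k is k'.+1 then euler k' + alpha (X (grid k) + A *m euler k')
  else alpha (X 0).

Let z k := X (grid k) + A *m euler k.

Lemma grid0 : grid 0 = 0. Proof. by rewrite /grid mul0r. Qed.

Lemma gridS k : grid k.+1 = grid k + n.+1%:R^-1.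
Proof. by rewrite /grid -natr1 mulrDl mul1r. Qed.

Lemma gridS_lt k : grid k < grid k.+1.
Proof. by rewrite gridS ltrDl invr_gt0. Qed.

Lemma euler_polyhedron k : polyhedron D (z k).
Proof.
rewrite /z; case: k => [|k] /=; first by rewrite grid0; have [] := alphaP (X 0).
by rewrite mulmxDr addrA; have [] := alphaP (X (grid k.+1) + A *m euler k).
Qed.

Lemma euler_incr k i : euler k i 0 <= euler k.+1 i 0.
Proof. by rewrite /= mxE lerDl; have [] := alphaP (X (grid k.+1) + A *m euler k). Qed.

Lemma euler_active k i : euler k.+1 i 0 != euler k i 0 -> active D (z k.+1) i.
Proof.
rewrite /z /= mxE -subr_eq0 addrAC subrr add0r mulmxDr addrA.
by have [_ + _] := alphaP (X (grid k.+1) + A *m euler k); exact.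
Qed.

Lemma euler_mono j k i : (j <= k)%N -> euler j i 0 <= euler k i 0.
Proof.
elim: k => [|k IH]; first by rewrite leqn0 => /eqP ->.
rewrite leq_eqVlt => /predU1P[-> //|]; rewrite ltnS => /IH h.
exact: le_trans h (euler_incr _ _).
Qed.

Lemma euler_support j k i : (j <= k)%N -> euler k i 0 != euler j i 0 ->
  exists l, [/\ (j < l)%N, (l <= k)%N & active D (z l) i].
Proof.
elim: k => [|k IH]; first by rewrite leqn0 => /eqP ->; rewrite eqxx.
rewrite leq_eqVlt => /predU1P[->|]; first by rewrite eqxx.
rewrite ltnS => jk; have [->|ne _] := eqVneq (euler k.+1 i 0) (euler k i 0).
  by move=> /(IH jk)[l [jl lk al]]; exists l; split => //; exact: leqW.
by exists k.+1; split => //; exact: euler_active.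
Qed.

Definition step (t : R) : nat := Num.truncn (t * n.+1%:R).

Lemma stepP t : 0 <= t -> grid (step t) <= t /\ t < grid (step t).+1.
Proof.
move=> t0; rewrite /grid ler_pdivrMr // ltr_pdivlMr //.
by have /andP[] := @truncn_itv _ (t * n.+1%:R) (mulr_ge0 t0 (ler0n _ _)).
Qed.

Lemma step_eq t k : grid k <= t -> t < grid k.+1 -> step t = k.
Proof.
rewrite /grid ler_pdivrMr // ltr_pdivlMr // => kt tk.
by apply: truncn_def; rewrite kt.
Qed.

Lemma step_mono s t : s <= t -> (step s <= step t)%N.
Proof. by move=> st; rewrite le_truncn // ler_wpM2r. Qed.

Lemma grid_mono j k : (j <= k)%N -> grid j <= grid k.
Proof. by move=> jk; rewrite ler_wpM2r ?ler_nat // invr_ge0. Qed.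

Lemma grid_ge0 k : 0 <= grid k.
Proof. by rewrite divr_ge0. Qed.

Definition stepX (t : R) : 'cV[R]_J := X (grid (step t)).
Definition stepL (t : R) : 'cV[R]_N := euler (step t).

Lemma stepX_near t : 0 <= t ->
  exists s, [/\ 0 <= s, s <= t, t - s < n.+1%:R^-1 & stepX t = X s].
Proof.
move=> t0; have [gt tg] := stepP t0; exists (grid (step t)).
by split => //; [exact: grid_ge0|rewrite ltrBlDl -gridS].
Qed.

Lemma stepL0 : stepL 0 = alpha (X 0).
Proof. by rewrite /stepL /step mul0r truncn0. Qed.

Lemma stepL_support s t i : 0 <= s -> s < t -> stepL t i 0 != stepL s i 0 ->
  exists u, [/\ s < u, u <= t & active D (stepX u + A *m stepL u) i].
Proof.
move=> s0 st; have t0 := le_lt_trans s0 st.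
move=> /(euler_support (step_mono (ltW st)))[l [sl lt al]].
have gl : step (grid l) = l by apply: step_eq => //; exact: gridS_lt.
exists (grid l); rewrite /stepX /stepL gl; split => //.
  exact: lt_le_trans (stepP s0).2 (grid_mono sl).
exact: le_trans (grid_mono lt) (stepP (ltW t0)).1.
Qed.

Lemma step_gen_sol : gen_sol D stepX (fun t => A *m stepL t).
Proof.
split.
- by move=> t _; exact: euler_polyhedron.
- rewrite stepL0 /stepX /step mul0r truncn0 grid0.
  by have [a0 aA _] := alphaP (X 0); exists (alpha (X 0)).
(* Less than one mesh width to the left of [t] at most one projection takes place, and the step
   solution still sits at its result at time [t]. *)
- move=> t t0; exists n.+1%:R^-1 => [|s s0 ts st]; first by rewrite invr_gt0.
  have [gt tg] := stepP (ltW t0); have [gs sg] := stepP s0.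
  have := step_mono (ltW st); rewrite leq_eqVlt => /predU1P[E|lt_st].
    by rewrite /stepL E subrr; exact: pos_comb0.
  have [k kE] : exists k, step t = k.+1 by case: (step t) lt_st => // k _; exists k.
  have sk : step s = k.
    move: lt_st; rewrite kE ltnS leq_eqVlt => /predU1P[//|lk].
    have sk := lt_le_trans sg (grid_mono lk).
    move: gt ts; rewrite kE gridS => gt ts; exfalso.
    have := lt_le_trans ts (ltW sk); rewrite ltrBlDr => /(le_lt_trans gt).
    by rewrite ltxx.
  rewrite /stepX /stepL sk kE -mulmxBr.
  exists (euler k.+1 - euler k); split => // i.
    by rewrite mxE [X in _ + X]mxE subr_ge0 euler_incr.
  by rewrite mxE [X in _ + X]mxE subr_eq0; exact: euler_active.
- move=> t e t0 e0; have [gt tg] := stepP t0.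
  exists (grid (step t).+1 - t) => [|s ts sr]; first by rewrite subr_gt0.
  have E : step s = step t.
    by apply: step_eq; [exact: le_trans gt (ltW ts)|lra].
  by rewrite /stepL E subrr normr0.
Qed.

End Steps.

Lemma mx_dist_ge_entry {R : realType} m n (x y : 'M[R]_(m, n)) i j :
  `|x i j - y i j| <= `|x - y|.
Proof. by have := mx_norm_ge_entry (x - y) i j; rewrite !mxE. Qed.

(** * From approximate to exact contact with the faces *)

Section ExactSupport.
Context {R : realType} {J N : nat}.
Variable D : sp_data R J N.
Hypothesis wfD : sp_data_wf D.
Variables (Z : R -> 'cV[R]_J) (L : R -> 'cV[R]_N).
Hypotheses (cZ : cont_path Z) (GZ : forall t, 0 <= t -> polyhedron D (Z t)).
Hypothesis supL : forall eta T : R, 0 < eta -> supported_near D Z eta T L.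

(** Near [t] only directions active at [Z t] carry increments of [L], so independence transfers the
    continuity of the displacement to the coefficients. *)
Lemma supported_cont : lin_indep_condition D ->
  cont_path (fun t => refl_mx D *m L t) -> cont_path L.
Proof.
move=> /(lin_indep_bound)[K K0 KP] /cont_pathP cY.
apply/cont_pathP => t e t0 e0.
have [eta [r [eta0 r0 near]]] := active_near_path wfD cZ GZ t0.
have [d d0 dY] := cY t (e / K) t0 (divr_gt0 e0 K0).
suff H : forall a b, 0 <= a -> a < b -> `|a - t| < r -> `|b - t| < r ->
    `|L b - L a| <= K * `|refl_mx D *m L b - refl_mx D *m L a|.
  exists (Num.min r d) => [|s s0]; first by rewrite lt_min r0.
  rewrite lt_min => /andP[sr sd].
  have t1 : `|t - t| < r by rewrite subrr normr0.
  have := dY s s0 sd; rewrite ltr_pdivlMr // mulrC => h.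
  have [st|ts|->] := ltgtP s t; last by rewrite subrr normr0.
    rewrite distrC (le_lt_trans (H _ _ s0 st sr t1)) //.
    by rewrite distrC.
  by rewrite (le_lt_trans (H _ _ t0 ts t1 sr)).
move=> a b a0 ab; rewrite !ltr_norml => /andP[ra ar] /andP[rb br].
rewrite -mulmxBr; apply: (KP (Z t)) => [|i]; first exact: GZ.
rewrite !mxE subr_eq0 => /((supL b eta0).2 _ _ _ a0 ab (lexx _))[u [au ub ui]].
apply: (near u) => //; first exact: ltW (le_lt_trans a0 au).
by rewrite ltr_norml; apply/andP; split; lra.
Qed.

Lemma supported_start i : L 0 i 0 != 0 -> active D (Z 0) i.
Proof.
move=> Li; apply/activeP => //; first exact: GZ.
apply/eqP; rewrite eq_le (GZ (lexx 0)) andbT.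
by apply/ler_addgt0Pr => e e0; apply/ltW/(supL 0 e0).1.
Qed.

(** If face [i] were missed after [s] and up to [t], the slack would have a positive minimum on each
    [[a, t]] with [a > s]; taken as [eta], it shows that component [i] of [L] agrees at [a] and [t].
    Continuity of [L] lets [a] tend to [s]. *)
Lemma supported_exact s t i : cont_path L -> 0 <= s -> s < t ->
  L t i 0 != L s i 0 -> exists u, [/\ s < u, u <= t & active D (Z u) i].
Proof.
move=> /cont_pathP cL s0 st; apply: contraPP => nu.
have slack u : s < u -> u <= t -> spc D i < dotv (Z u) (spn D i).
  move=> su ut; have u0 := ltW (le_lt_trans s0 su).
  rewrite lt_neqAle (GZ u0) andbT; apply/eqP => ui.
  by apply: nu; exists u; split => //; apply/activeP => //; exact: GZ.
have const a : s < a -> a < t -> L t i 0 = L a i 0.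
  move=> sa at_; have a0 := ltW (le_lt_trans s0 sa).
  have cf : {within `[a, t], continuous (fun u => dotv (Z u) (spn D i))}.
    apply/subspace_continuousP => u; rewrite /= in_itv /= => /andP[au ut].
    apply/cvgrPdist_lt => e e0; rewrite near_withinE; apply/nbhs_normP.
    have [C C0 Cb] := @dotv_norm_bound R J.
    pose k := C * (`|spn D i| + 1).
    have k0 : 0 < k by rewrite mulr_gt0 // ltr_wpDl.
    have /cont_pathP/(_ u _ (le_trans a0 au) (divr_gt0 e0 k0))[r r0 rP] := cZ.
    exists r => // v /= uv; rewrite in_itv /= => /andP[av _].
    have := rP v (le_trans a0 av); rewrite distrC => /(_ uv).
    rewrite ltr_pdivlMr // -dotvNl -dotvDl distrC => h.
    apply: le_lt_trans (Cb _ _) (le_lt_trans _ h).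
    by rewrite /k mulrCA mulrA ler_wpM2l ?mulr_ge0 ?(ltW C0) // lerDl.
  have [c] := EVT_min (ltW at_) cf; rewrite in_itv /= => /andP[ac ct] cmin.
  have c0 : 0 < dotv (Z c) (spn D i) - spc D i.
    by rewrite subr_gt0; apply: slack => //; exact: lt_le_trans ac.
  apply: contrapT => /eqP /((supL t c0).2 _ _ _ a0 at_ (lexx _))[u [au ut]].
  rewrite addrC subrK ltNge => /negP; apply; apply: cmin.
  by rewrite in_itv /= (ltW au).
apply/negP; rewrite negbK -subr_eq0 -normr_eq0 eq_le normr_ge0 andbT.
apply/ler_addgt0Pr => e e0; rewrite add0r.
have [r r0 rP] := cL s e s0 e0.
pose a := s + Num.min (t - s) r / 2.
have m0 : 0 < Num.min (t - s) r by rewrite lt_min subr_gt0 st.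
have m1 : Num.min (t - s) r <= t - s by rewrite ge_min lexx.
have m2 : Num.min (t - s) r <= r by rewrite ge_min lexx orbT.
have sa : s < a by rewrite /a; lra.
rewrite (const a) //; last by rewrite /a; lra.
apply: le_trans (mx_dist_ge_entry _ _ _ _) (ltW (rP _ _ _)).
  by rewrite ltW // (le_lt_trans s0).
by rewrite /a ltr_norml; apply/andP; split; lra.
Qed.

End ExactSupport.

(** * Existence of solutions *)

Section Existence.
Context {R : realType} {J N : nat}.
Variable D : sp_data R J N.
Hypothesis wfD : sp_data_wf D.
Local Notation A := (refl_mx D).

Lemma grid_approx (X : R -> 'cV[R]_J) T e : cont_path X -> 0 < e ->
  exists n0, forall n t, (n0 <= n)%N -> 0 <= t -> t <= T ->
    `|stepX X n t - X t| <= e.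
Proof.
move=> cX e0; have [T0|T0] := ltP T 0.
  by exists 0 => n t _ t0 tT; have := le_lt_trans (le_trans t0 tT) T0; rewrite ltxx.
have [d d0 dP] := unif_cont_path cX T0 e0.
(* From this index on the mesh width is at most [d]. *)
exists (Num.truncn d^-1) => n t n0n t0 tT.
have [s [s0 st tsn ->]] := stepX_near X n t0.
rewrite distrC ltW // dP // (lt_le_trans tsn) //.
rewrite -[leRHS]invrK lef_pV2 ?posrE ?invr_gt0 // ltW //.
by apply: lt_le_trans (truncnS_gt _) _; rewrite ler_nat.
Qed.

(** Lipschitz continuity makes the displacements of the step solutions converge. Their coefficients
    converge too: a difference of two of them is supported near the faces met by the limit [Z],
    where [reflection_inverse] applies. *)
Theorem skorokhod_exists (X : R -> 'cV[R]_J) :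
  set_B_condition D -> projection_condition D -> lin_indep_condition D ->
  cont_path X -> exists L, let Z t := X t + A *m L t in
    [/\ cont_path L, forall t, 0 <= t -> polyhedron D (Z t) & pushes D Z L].
Proof.
move=> setB /(projection_push)[alpha alphaP] li cX.
pose Xn := stepX X; pose Ln := stepL D X alpha.
pose Zn n t := Xn n t + A *m Ln n t.
have solN n : gen_sol D (Xn n) (fun t => A *m Ln n t) by exact: step_gen_sol.
have XnP (T e : R) : 0 < e -> exists n0, forall n t, (n0 <= n)%N -> 0 <= t -> t <= T ->
    `|Xn n t - X t| <= e by exact: grid_approx.
have [K K0 KP] := skorokhod_lipschitz wfD setB.
have [Y YP] : exists Y : R -> 'cV[R]_J, forall T e : R, 0 < e -> exists n0, forall n t,
    (n0 <= n)%N -> 0 <= t -> t <= T -> `|A *m Ln n t - Y t| <= e.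
  apply: unif_cauchy_lim => T e e0.
  have b0 : 0 < e / K by exact: divr_gt0.
  have [n0 n0P] := XnP T _ (divr_gt0 b0 (ltr0Sn _ 1)).
  exists n0 => n k t n0n n0k t0 tT.
  have -> : e = K * (e / K) by rewrite mulrCA mulfV ?mulr1 // gt_eqF.
  apply: (KP _ _ _ _ T _ (solN n) (solN k)) => // s s0 sT.
  rewrite (le_trans (ler_distD (X s) _ _)) // [leRHS]splitr lerD ?n0P //.
  by rewrite distrC n0P.
have cY : cont_path Y.
  have [K' K'0 K'P] := skorokhod_oscillation wfD setB.
  apply/cont_pathP => t e t0 e0.
  (* The step input oscillates by at most [b], namely [b / 2] from [X] and [b / 4] from each of two
     grid errors; this costs [e / 2], and passing to the limit costs [e / 8] at each end. *)
  pose b := e / (2 * K').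
  have b0 : 0 < b by rewrite divr_gt0 // mulr_gt0.
  have b40 : 0 < b / 4 by rewrite divr_gt0.
  have e80 : 0 < e / 8 by rewrite divr_gt0.
  have /cont_pathP/(_ t _ t0 b40)[r r0 rP] := cX.
  suff H : forall a c, 0 <= a -> a <= c -> `|a - t| < r -> `|c - t| < r ->
      `|Y c - Y a| < e.
    exists r => // s s0 sr; have t1 : `|t - t| < r by rewrite subrr normr0.
    have [st|ts] := leP s t; last by apply: H => //; exact: ltW.
    by rewrite distrC; exact: H.
  move=> a c a0 ac ar cr.
  have [n1 n1P] := XnP (t + r) _ b40; have [n2 n2P] := YP (t + r) _ e80.
  pose n := maxn n1 n2.
  have n1n : (n1 <= n)%N by rewrite leq_maxl.
  have n2n : (n2 <= n)%N by rewrite leq_maxr.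
  move: ar cr; rewrite !ltr_norml => /andP[ra ar] /andP[rc cr].
  have cT : c <= t + r by lra.
  have c0 : 0 <= c by exact: le_trans ac.
  have osc : `|A *m Ln n c - A *m Ln n a| <= K' * b.
    apply: (K'P _ _ _ _ _ (solN n)) => // u au uc.
    have u0 : 0 <= u by exact: le_trans au.
    have ub : `|X u - X a| <= b / 4 + b / 4.
      rewrite (le_trans (ler_distD (X t) _ _)) // lerD // ltW //.
        by apply: rP => //; rewrite ltr_norml; apply/andP; split; lra.
      by rewrite distrC rP // ltr_norml; apply/andP; split; lra.
    have h1 := n1P n u n1n u0 (le_trans uc cT).
    have h2 := n1P n a n1n a0 (le_trans ac cT).
    have -> : Xn n u - Xn n a = (Xn n u - X u) + (X u - X a) - (Xn n a - X a).
      by apply/matrixP => i j; rewrite !mxE; ring.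
    rewrite (le_trans (ler_normB _ _)) //.
    by have := ler_normD (Xn n u - X u) (X u - X a); lra.
  have h1 := n2P n c n2n c0 cT.
  have h2 := n2P n a n2n a0 (le_trans ac cT).
  have bK : K' * b = e / 2 by rewrite /b; field; rewrite gt_eqF.
  have -> : Y c - Y a = (A *m Ln n c - A *m Ln n a) - (A *m Ln n c - Y c)
      + (A *m Ln n a - Y a).
    by apply/matrixP => i j; rewrite !mxE; ring.
  rewrite (le_lt_trans (ler_normD _ _)) //.
  have := ler_normB (A *m Ln n c - A *m Ln n a) (A *m Ln n c - Y c); lra.
pose Z t := X t + Y t.
have cZ : cont_path Z by exact: cont_pathD.
have ZnP (T e : R) : 0 < e -> exists n0, forall n t, (n0 <= n)%N -> 0 <= t -> t <= T ->
    forall i, `|dotv (Zn n t) (spn D i) - dotv (Z t) (spn D i)| < e.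
  move=> e0; have [C C0 Cb] := @dotv_norm_bound R J.
  pose s := 1 + \sum_i `|spn D i|.
  have s0 : 0 < s by rewrite ltr_pwDl // sumr_ge0.
  have ns i : `|spn D i| < s.
    by rewrite /s (bigD1 i) //= ltr_pwDl // lerDl sumr_ge0.
  pose d := e / (2 * C * s).
  have d0 : 0 < d by rewrite divr_gt0 // !mulr_gt0.
  have [n1 n1P] := XnP T _ d0; have [n2 n2P] := YP T _ d0.
  exists (maxn n1 n2) => n t; rewrite geq_max => /andP[n1n n2n] t0 tT i.
  rewrite -dotvNl -dotvDl (le_lt_trans (Cb _ _)) //.
  have h : `|Zn n t - Z t| <= 2 * d.
    rewrite opprD addrACA (le_trans (ler_normD _ _)) // mulr_natl mulr2n.
    by rewrite lerD ?n1P ?n2P.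
  have -> : e = C * (2 * d) * s by rewrite /d; field; rewrite !gt_eqF.
  apply: (@le_lt_trans _ _ (C * (2 * d) * `|spn D i|)).
    by rewrite ler_wpM2r // ler_wpM2l // ltW.
  by rewrite ltr_pM2l ?ns // mulr_gt0 // mulr_gt0.
have GZ (t : R) : 0 <= t -> polyhedron D (Z t).
  move=> t0 i; apply/ler_addgt0Pr => e e0.
  have [n0 /(_ n0 t (leqnn _) t0 (lexx _) i)] := ZnP t _ e0.
  have [/(_ t t0 i) + _ _ _] := solN n0; rewrite -/(Zn n0 t) ltr_norml.
  by move=> ? /andP[? ?]; lra.
have supN (eta T : R) : 0 < eta -> exists n0, forall n, (n0 <= n)%N ->
    supported_near D Z eta T (Ln n).
  (* [T] may be negative, whereas the clause at time 0 has to hold in any case. *)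
  move=> eta0; have [n0 n0P] := ZnP (Num.max 0 T) _ eta0; exists n0 => n n0n.
  have near u i : 0 <= u -> u <= Num.max 0 T -> active D (Zn n u) i ->
      dotv (Z u) (spn D i) < spc D i + eta.
    move=> u0 uT [_ <-]; have := n0P n u n0n u0 uT i.
    by rewrite ltr_norml => /andP[? ?]; lra.
  split => [i Li|s r i s0 sr rT /(stepL_support alphaP)].
    apply: near; rewrite ?le_max ?lexx // /Zn.
    have := alphaP (X 0); rewrite /Xn /Ln stepL0 /stepX /step mul0r truncn0 grid0.
    by case=> _ aA' _; apply: aA'; rewrite -(stepL0 D X alpha n).
  move=> /(_ s0 sr)[u [su ur ui]]; exists u; split => //; apply: near => //.
    exact: ltW (le_lt_trans s0 su).
  by rewrite le_max (le_trans ur rT) orbT.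
have [L LP] : exists L : R -> 'cV[R]_N, forall T e : R, 0 < e -> exists n0, forall n t,
    (n0 <= n)%N -> 0 <= t -> t <= T -> `|Ln n t - L t| <= e.
  apply: unif_cauchy_lim => T e e0.
  have T0 : 0 <= Num.max 0 T by rewrite le_max lexx.
  have [C [eta [C0 eta0 CP]]] := reflection_inverse wfD li cZ GZ T0.
  have e20 : 0 < e / C / 2 by rewrite !divr_gt0.
  have [n1 n1P] := supN eta (Num.max 0 T) eta0.
  have [n2 n2P] := YP (Num.max 0 T) _ e20.
  exists (maxn n1 n2) => n k t; rewrite !geq_max => /andP[n1n n2n] /andP[n1k n2k] t0 tT.
  have tT' : t <= Num.max 0 T by rewrite le_max tT orbT.
  have -> : e = C * (e / C) by rewrite mulrCA mulfV ?mulr1 // gt_eqF.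
  (* A nonzero increment of the difference comes from at least one of the two step solutions, and
     each of them moves only near the faces. *)
  apply: (CP t (fun s => Ln n s - Ln k s)) => // [|s s0 st].
    have [S0 S1] := n1P n n1n; have [S0' S1'] := n1P k n1k.
    split => [i|s r i s0 sr rt].
      rewrite !mxE => h; have [E|/S0//] := eqVneq (Ln n 0 i 0) 0.
      by apply: S0'; apply: contraNneq h => ->; rewrite E subrr.
    rewrite !mxE => h; have rT := le_trans rt tT'.
    have [E|/(S1 _ _ _ s0 sr rT)//] := eqVneq (Ln n r i 0) (Ln n s i 0).
    by apply: S1' => //; apply: contraNneq h => ->; rewrite E.
  rewrite mulmxBr (le_trans (ler_distD (Y s) _ _)) // [leRHS]splitr.
  have sT := le_trans st tT'.
  by rewrite lerD ?n2P // distrC n2P.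
have AL (t : R) : 0 <= t -> A *m L t = Y t.
  move=> t0; have [C C0 CP] := mulmx_norm_bound A.
  apply/eqP; rewrite -subr_eq0 -normr_eq0 eq_le normr_ge0 andbT.
  apply/ler_addgt0Pr => e e0; rewrite add0r.
  have C1 : 0 < C + 1 by rewrite ltr_wpDl.
  have d0 : 0 < e / 2 / (C + 1) by rewrite !divr_gt0.
  have e20 : 0 < e / 2 by rewrite divr_gt0.
  have [n1 n1P] := LP t _ d0; have [n2 n2P] := YP t _ e20.
  pose n := maxn n1 n2.
  have h1 := n1P n t (leq_maxl _ _) t0 (lexx _).
  have h2 := n2P n t (leq_maxr _ _) t0 (lexx _).
  rewrite (le_trans (ler_distD (A *m Ln n t) _ _)) // [leRHS]splitr lerD //.
  rewrite -mulmxBr (le_trans (CP _)) // distrC.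
  rewrite ler_pdivlMr // in h1.
  by have := normr_ge0 (Ln n t - L t); lra.
have supL (eta T : R) : 0 < eta -> supported_near D Z eta T L.
  move=> eta0; have [n1 n1P] := supN eta T eta0.
  split => [i Li|s r i s0 sr rT Lrs].
    have d0 : 0 < `|L 0 i 0| / 2 by rewrite divr_gt0 // normr_gt0.
    have [n2 n2P] := LP 0 _ d0.
    have h := n2P (maxn n1 n2) 0 (leq_maxr _ _) (lexx _) (lexx _).
    apply: (n1P _ (leq_maxl n1 n2)).1; apply/eqP => E.
    have := le_trans (mx_dist_ge_entry _ _ i 0) h.
    by rewrite E sub0r normrN; lra.
  (* With an error of one third at each end, the increment of [Ln] cannot vanish. *)
  have d0 : 0 < `|L r i 0 - L s i 0| / 3 by rewrite divr_gt0 // normr_gt0 subr_eq0.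
  have [n2 n2P] := LP r _ d0.
  have r0 := ltW (le_lt_trans s0 sr).
  have h1 := n2P (maxn n1 n2) r (leq_maxr _ _) r0 (lexx _).
  have h2 := n2P (maxn n1 n2) s (leq_maxr _ _) s0 (ltW sr).
  apply: (n1P _ (leq_maxl n1 n2)).2 => //; apply/eqP => E.
  have := le_trans (mx_dist_ge_entry _ _ i 0) h1.
  have := le_trans (mx_dist_ge_entry _ _ i 0) h2.
  rewrite E => g2 g1; have := ler_distD (Ln (maxn n1 n2) s i 0) (L r i 0) (L s i 0).
  by rewrite (distrC (L r i 0) (Ln _ _ _ _)); lra.
have cL : cont_path L.
  apply: (supported_cont wfD cZ GZ supL li).
  apply/cont_pathP => t e t0 e0; have /cont_pathP/(_ t e t0 e0)[r r0 rP] := cY.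
  by exists r => // s s0 sr; rewrite !AL // rP.
have ZE (t : R) : 0 <= t -> X t + A *m L t = Z t by move=> t0; rewrite AL.
have Ln_lim (t : R) i (e : R) : 0 <= t -> 0 < e -> exists n0, forall n, (n0 <= n)%N ->
    `|Ln n t i 0 - L t i 0| <= e.
  move=> t0 e0; have [n0 n0P] := LP t e e0; exists n0 => n n0n.
  by apply: le_trans (mx_dist_ge_entry _ _ _ _) _; exact: n0P.
exists L; split => //.
- by move=> t t0; rewrite ZE //; exact: GZ.
- split.
  + move=> i; apply/ler_addgt0Pr => e e0.
    have [n0 /(_ n0 (leqnn _))] := Ln_lim 0 i e (lexx _) e0.
    rewrite /Ln stepL0 ler_norml => /andP[_]; have [/(_ i) + _ _] := alphaP (X 0).
    move=> a0 h; move: a0 h; set a := alpha _ _ _; set b := L _ _ _; lra.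
  + by move=> i Li; rewrite ZE //; exact: (supported_start wfD GZ supL).
  + move=> s t i s0 st; apply/ler_addgt0Pr => e e0.
    have e20 : 0 < e / 2 by rewrite divr_gt0.
    have [n1 n1P] := Ln_lim s i _ s0 e20.
    have [n2 n2P] := Ln_lim t i _ (le_trans s0 st) e20.
    have := n1P _ (leq_maxl n1 n2); have := n2P _ (leq_maxr n1 n2).
    have : Ln (maxn n1 n2) s i 0 <= Ln (maxn n1 n2) t i 0.
      exact: (euler_mono X alphaP (maxn n1 n2) i (step_mono (maxn n1 n2) st)).
    by rewrite !ler_norml => ? /andP[? ?] /andP[? ?]; lra.
  + move=> s t i s0 st /(supported_exact wfD cZ GZ supL cL s0 st)[u [su ut ui]].
    by exists u; split => //; rewrite ZE // ltW // (le_lt_trans s0).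
Qed.

End Existence.

(** * Complementarity in terms of the Stieltjes measure *)

Section ChargesFace.
Context {R : realType} {J N : nat}.
Variable D : sp_data R J N.
Hypothesis wfD : sp_data_wf D.

(** If the face were missed, the interval would lie in the set of times off the face, which is null
    for the measure of component [i]; the mass of the interval is the increment, so there could be
    no growth. *)
Lemma charges_support Z (L : R -> 'cV[R]_N) i (s t : R) :
  cont_path Z -> (forall t, 0 <= t -> polyhedron D (Z t)) ->
  charges_only_face D Z L i -> 0 <= s -> s < t -> L t i 0 != L s i 0 ->
  L s i 0 <= L t i 0 -> exists u, [/\ s < u, u <= t & active D (Z u) i].
Proof.
move=> cZ GZ [f [fE f0]] s0 st /eqP ne Lst; apply: contrapT => nu.
pose I := `[0%R, +oo[%classic : set R.
(* Freezing [Z] at its initial value for negative times makes this set open in the whole line, hence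
   measurable. *)
pose O : set R := [set u | ~ face D i (Z (Num.max 0 u))].
have oO : open O.
  rewrite openE => u Ou; set u' := Num.max 0 u.
  have u'0 : 0 <= u' by rewrite le_max lexx.
  have [eta [r [eta0 r0 near]]] := active_near_path wfD cZ GZ u'0.
  apply/nbhs_normP; exists r => // v /= uv /(active_lt eta0) h; apply: Ou.
  apply: near h; first by rewrite le_max lexx.
  rewrite distrC; apply: le_lt_trans uv.
  rewrite /u' /Num.max; case: ltP => ?; case: ltP => ?;
    rewrite ler_norml; have := ler_norm (u - v); have := ler_normr (u - v) (v - u);
    move: (ler_norm (- (u - v))); rewrite normrN => ? ? ?; apply/andP; split; lra.
have mO : measurable O by exact: measurable_realfun.open_measurable.
have mI : measurable I by exact: measurable_itv.
have : lebesgue_stieltjes_measure f (O `&` I) = 0%E.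
  rewrite -integral_indic // -[RHS]f0; apply: eq_integral => u.
  rewrite inE /I /= in_itv /= andbT => u0; congr (_%:E).
  by rewrite /indic; congr (_%:R); congr nat_of_bool; apply/idP/idP;
    rewrite !inE /O /= max_r.
have sub : `]s, t]%classic `<=` O `&` I.
  move=> u /=; rewrite !in_itv /= => /andP[su ut].
  have u0 := ltW (le_lt_trans s0 su).
  by split; [rewrite /O /= max_r // => fu; apply: nu; exists u|rewrite /I /= in_itv /= u0].
have mle : (lebesgue_stieltjes_measure f `]s, t]%classic <=
    lebesgue_stieltjes_measure f (O `&` I))%E.
  by apply: le_measure => //; rewrite inE; [exact: measurable_itv|exact: measurableI].
move=> mu0; rewrite mu0 in mle.
have : (lebesgue_stieltjes_measure f `]s, t]%classic = (f t - f s)%:E)%E.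
  rewrite /lebesgue_stieltjes_measure /measure_extension measurable_mu_extE /=.
    by rewrite wlength_itv_bnd // ltW.
  exact: is_ocitv.
move=> mE; move: mle; rewrite mE lee_fin !fE !max_r //; last first.
  exact: ltW (le_lt_trans s0 st).
by rewrite subr_le0 => h; apply: ne; apply/eqP; rewrite eq_le h.
Qed.

End ChargesFace.

(** * Uniqueness, perturbed data and a continuity argument *)

Section SkorokhodMap.
Context {R : realType} {J N : nat}.
Implicit Types (D : sp_data R J N) (v : 'I_N -> 'cV[R]_J).

(** Uniqueness is the Lipschitz estimate for equal inputs with arbitrarily small [b]; the given
    solution rules out the dummy value. *)
Lemma skorokhod_mapE D X Z Y t : sp_data_wf D -> set_B_condition D ->
  solves_SP D X Z Y -> 0 <= t -> skorokhod_map D X t = Z t.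
Proof.
move=> wfD /(skorokhod_lipschitz wfD)[K K0 KP] sol t0.
have [Y' sol'] : exists Y, solves_SP D X (skorokhod_map D X) Y.
  by rewrite /skorokhod_map; case: xgetP => [Z' _ //|/(_ Z)[]]; exists Y.
have [_ _ _ _ /(_ t t0)[-> _ _]] := sol.
have [_ _ _ _ /(_ t t0)[-> _ _]] := sol'.
congr (_ + _); apply/eqP; rewrite -subr_eq0 -normr_eq0 eq_le normr_ge0 andbT.
apply/ler_addgt0Pr => e e0; rewrite add0r.
have -> : e = K * (e / K) by rewrite mulrCA mulfV ?mulr1 // gt_eqF.
apply: (KP X _ X _ t _ (solves_gen_sol wfD sol') (solves_gen_sol wfD sol)) => //.
  exact: divr_gt0.
by move=> s _ _; rewrite subrr normr0 ltW // divr_gt0.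
Qed.

Lemma perturb0 D v : perturb D v 0 = D.
Proof.
by case: D => d n c; congr SPData; apply/funext => i; rewrite scale0r addr0.
Qed.

Lemma perturb_wf D v e : sp_data_wf D -> tangential D v -> sp_data_wf (perturb D v e).
Proof.
move=> [n1 dn U] tv; split => // i.
by rewrite dotvDl dotvZl tv mulr0 addr0.
Qed.

Lemma perturb_mx D v e (a : 'cV[R]_N) :
  refl_mx (perturb D v e) *m a = refl_mx D *m a + e *: (matrix_of_cols v *m a).
Proof.
rewrite scalemxAl -mulmxDl; congr (_ *m _).
by apply/matrixP => i j; rewrite !mxE.
Qed.

Lemma cont_pathZ n (f : R -> 'cV[R]_n) e : cont_path f -> cont_path (fun t => e *: f t).
Proof.
move=> cf; have := cont_path_mulmx (A := e%:M) cf.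
by congr cont_path; apply/funext => t; rewrite mul_scalar_mx.
Qed.

Lemma cont_path_bounded n (f : R -> 'cV[R]_n) t : cont_path f ->
  exists2 b, 0 < b & forall s, 0 <= s -> s <= t -> `|f s| <= b.
Proof.
move=> cf; have cI : {within `[0, t], continuous f}.
  apply: continuous_subspaceW cf => s /=; rewrite !in_itv /= => /andP[-> _] //.
have [M [_ MP]] := compact_bounded (continuous_compact cI (@segment_compact _ 0 t)).
exists (`|M| + 1) => [|s s0 st]; first by rewrite ltr_wpDl.
apply: (MP (`|M| + 1)); first by rewrite (le_lt_trans (ler_norm M)) // ltrDl.
by exists s => //=; rewrite in_itv /= s0.
Qed.

(** The bound [M] passes to limits from the left, and its improvement by [1 / 2] leaves room for
    continuity to carry it beyond [s]. *)
Lemma cont_path_bootstrap n (f : R -> 'cV[R]_n) (M t : R) : cont_path f ->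
  `|f 0| <= M ->
  (forall s, 0 <= s -> s <= t -> (forall r, 0 <= r -> r <= s -> `|f r| <= M) ->
     `|f s| <= M - 1 / 2) ->
  forall s, 0 <= s -> s <= t -> `|f s| <= M.
Proof.
move=> /cont_pathP cf f0 fM.
suff H : forall s, 0 <= s -> s <= t -> forall r, 0 <= r -> r <= s -> `|f r| <= M.
  by move=> s s0 st; exact: (H s).
apply: real_induction => s s0.
  move=> IH st r r0; rewrite le_eqVlt => /predU1P[->|rs]; last first.
    by apply: (IH r) => //; exact: le_trans (ltW rs) st.
  move: (s0); rewrite le_eqVlt => /predU1P[<- //|sp].
  apply/ler_addgt0Pr => d d0; have [w w0 wP] := cf s d s0 d0.
  pose a := Num.max 0 (s - w / 2).
  have a0 : 0 <= a by rewrite le_max lexx.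
  have as_ : a < s by rewrite gt_max sp /=; lra.
  have aw : s - w < a by rewrite lt_max; apply/orP; right; lra.
  have := IH a a0 as_ (le_trans (ltW as_) st) a a0 (lexx _).
  have : `|f a - f s| < d by apply: wP => //; rewrite ltr_norml; apply/andP; split; lra.
  have -> : `|f s| = `|f a - (f a - f s)| by rewrite opprB addrC subrK.
  by have := ler_normB (f a) (f a - f s); lra.
move=> Ps; have half0 : (0 : R) < 1 / 2 by lra.
have [w w0 wP] := cf s _ s0 half0.
exists w => // u su uw ut r r0 ru; have st : s <= t by exact: le_trans (ltW su) ut.
have [rs|sr] := leP r s; first exact: (Ps st).
have h := fM s s0 st (Ps st).
have rw : `|r - s| < w by rewrite ltr_norml; apply/andP; split; lra.
have h2 := wP r r0 rw; have -> : f r = (f r - f s) + f s by rewrite subrK.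
by rewrite (le_trans (ler_normD _ _)) //; lra.
Qed.

End SkorokhodMap.

(** * Comparison of the perturbed and unperturbed pushing processes *)

Section PerturbedPush.
Context {R : realType} {J N : nat}.
Variables (D : sp_data R J N) (v : 'I_N -> 'cV[R]_J).
Hypotheses (wfD : sp_data_wf D) (tv : tangential D v).
Hypotheses (setB : set_B_condition D) (li : lin_indep_condition D).
Variables (X Z zeta : R -> 'cV[R]_J) (L : R -> 'cV[R]_N).
Hypotheses (cX : cont_path X) (L0 : L 0 = 0).
Hypothesis sol : solves_SP D X Z (fun t => refl_mx D *m L t).
Hypothesis pL : pushes D Z L.
Hypothesis czeta : cont_path zeta.
Local Notation A := (refl_mx D).
Local Notation V := (matrix_of_cols v).

(* Absorbing the perturbed directions into the input: [R + e V] pushing by [Le]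
   is [R] pushing by [Le] for the input [X + e zeta + e V Le]. *)
Lemma perturb_solves e Le : cont_path Le ->
  let Ze t := X t + e *: zeta t + refl_mx (perturb D v e) *m Le t in
  (forall t, 0 <= t -> polyhedron D (Ze t)) -> pushes (perturb D v e) Ze Le ->
  solves_SP (perturb D v e) (fun t => X t + e *: zeta t) Ze
    (fun t => refl_mx (perturb D v e) *m Le t) /\
  solves_SP D (fun t => X t + e *: (zeta t + V *m Le t)) Ze (fun t => A *m Le t).
Proof.
move=> cLe Ze GZ pLe; split.
  apply: pushes_solves => //; first exact: perturb_wf.
  by apply: cont_pathD => //; exact: cont_pathZ.
apply: pushes_solves => //.
  by apply: cont_pathD => //; apply/cont_pathZ/cont_pathD => //; exact: cont_path_mulmx.
move=> t _; rewrite /Ze perturb_mx scalerDr.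
by apply/matrixP => i j; rewrite !mxE; ring.
Qed.

(** While [Le] is bounded by [M], the unperturbed problem is solved for two inputs at distance at
    most [e * c]. Hence [Ze] touches only faces that [Z] nearly touches, and [reflection_inverse]
    yields the estimate, which in turn improves the bound on [Le]. *)
Lemma perturbed_push_close t : 0 <= t -> exists C e1 : R, [/\ 0 < C, 0 < e1 &
  forall e Le, 0 < e -> e < e1 -> cont_path Le ->
  let Ze t := X t + e *: zeta t + refl_mx (perturb D v e) *m Le t in
  (forall t, 0 <= t -> polyhedron D (Ze t)) -> pushes (perturb D v e) Ze Le ->
  forall s, 0 <= s -> s <= t -> `|Le s - L s| <= C * e].
Proof.
move=> t0.
have [_ cZ _ _ ZP] := sol.
have GZ s : 0 <= s -> polyhedron D (Z s) by move=> /ZP[].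
have [KL KL0 KLP] := skorokhod_lipschitz wfD setB.
have [K K0 KP] := lin_indep_bound li.
have [C0 [eta [C00 eta0 CP]]] := reflection_inverse wfD li cZ GZ t0.
have [CV CV0 CVP] := mulmx_norm_bound V.
have [Cd Cd0 Cdb] := @dotv_norm_bound R J.
have [zb zb0 zbP] := cont_path_bounded t czeta.
(* By monotonicity [L] stays below [M - 1] on [[0, t]], which leaves one unit for the deviation of
   [Le]. *)
pose M := `|L t| + 1.
have M1 : 1 <= M by rewrite /M lerDr.
have LM s : 0 <= s -> s <= t -> `|L s| <= M - 1.
  move=> s0 st; rewrite /M addrK; have [Lpos _ Lm _] := pL.
  apply: mx_norm_le => // i k; rewrite (ord1 k).
  rewrite ger0_norm; last exact: le_trans (Lpos i) (Lm 0 s i (lexx _) s0).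
  by rewrite (le_trans (Lm s t i s0 st)) // (le_trans (ler_norm _)) // mx_norm_ge_entry.
pose ns := 1 + \sum_i `|spn D i|.
have ns0 : 0 < ns by rewrite ltr_pwDl // sumr_ge0.
have nsP i : `|spn D i| <= ns.
  by rewrite /ns (bigD1 i) //= addrCA lerDl addr_ge0 // sumr_ge0.
pose c := zb + CV * M.
have c0 : 0 < c by rewrite ltr_pwDl // mulr_ge0 //; lra.
pose C := C0 * (KL * c).
have CC0 : 0 < C by rewrite !mulr_gt0.
pose q1 := Cd * ((1 + KL) * c) * ns / eta.
have q10 : 0 < q1 by rewrite divr_gt0 // !mulr_gt0 // addr_gt0.
pose q2 := K * KL * (CV + 1).
have q20 : 0 < q2 by rewrite !mulr_gt0 // ltr_wpDl.
pose q3 := K * KL * zb.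
have q30 : 0 < q3 by rewrite !mulr_gt0.
(* [e * Q < 1] collects the smallness requirements: [q1] turns contacts of [Ze] into slack below
   [eta] for [Z], [C] keeps the deviation from [L] within [1 / 2], and [q2], [q3] control [Le 0]. *)
pose Q := q1 + 2 * C + 2 * q2 + 2 * q3.
have Q0 : 0 < Q by rewrite !addr_gt0 // mulr_gt0.
exists C, Q^-1; split; rewrite ?invr_gt0 // => e Le e0 eQ cLe Ze GZe pLe.
have {}eQ : e * Q < 1 by rewrite -ltr_pdivlMr // div1r.
have [eq1 eC eq2 eq3] : [/\ e * q1 < 1, e * C <= 1 / 2, e * q2 <= 1 / 2 & e * q3 <= 1 / 2].
  have p1 : 0 < e * q1 by exact: mulr_gt0.
  have p2 : 0 < e * C by exact: mulr_gt0.
  have p3 : 0 < e * q2 by exact: mulr_gt0.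
  have p4 : 0 < e * q3 by exact: mulr_gt0.
  by move: eQ; rewrite /Q !mulrDr !(mulrCA e 2) => eQ'; split; lra.
have [_ sole] := perturb_solves cLe GZe pLe.
have gen := solves_gen_sol wfD sol.
have gene := solves_gen_sol wfD sole.
have in_dist s m : 0 <= s -> s <= t -> `|Le s| <= m ->
    `|X s + e *: (zeta s + V *m Le s) - X s| <= e * (zb + CV * m).
  move=> s0 st Lem; rewrite addrAC subrr add0r normrZ gtr0_norm // ler_pM2l //.
  by rewrite (le_trans (ler_normD _ _)) // lerD ?zbP // (le_trans (CVP _)) // ler_wpM2l.
have claim s : 0 <= s -> s <= t -> (forall r, 0 <= r -> r <= s -> `|Le r| <= M) ->
    `|Le s - L s| <= C * e.
  move=> s0 st LeM.
  have ec0 : 0 < e * c by exact: mulr_gt0.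
  have dY r : 0 <= r -> r <= s -> `|A *m Le r - A *m L r| <= KL * (e * c).
    apply: (KLP _ _ _ _ s (e * c) gene gen) => // u u0 us.
    by apply: in_dist => //; [exact: le_trans st|exact: LeM].
  rewrite /C -mulrA -(mulrA KL) (mulrC c).
  apply: (CP s (fun r => Le r - L r)) => // [|r r0 rs]; last by rewrite mulmxBr dY.
  have near r i : 0 <= r -> r <= s -> active D (Ze r) i ->
      dotv (Z r) (spn D i) < spc D i + eta.
    move=> r0 rs [_ <-]; rewrite -ltrBlDl -dotvNl -dotvDl.
    apply: le_lt_trans (ler_norm _) _; apply: le_lt_trans (Cdb _ _) _.
    have dZ : `|Z r - Ze r| <= (1 + KL) * c * e.
      have ZeE : Ze r = X r + e *: (zeta r + V *m Le r) + A *m Le r.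
        by have [_ _ _ _ /(_ r r0)[]] := sole.
      have [-> _ _] := ZP r r0; rewrite ZeE distrC opprD addrACA (le_trans (ler_normD _ _)) //.
      have -> : (1 + KL) * c * e = e * c + KL * (e * c) by ring.
      apply: lerD; last by apply: dY.
      by apply: in_dist => //; [exact: le_trans st|exact: LeM].
    apply: (@le_lt_trans _ _ (Cd * ((1 + KL) * c * e) * ns)).
      by apply: ler_pM => //; [rewrite mulr_ge0 // ltW|rewrite ler_wpM2l // ltW].
    rewrite (_ : _ * ns = e * q1 * eta); last by rewrite /q1; field; rewrite gt_eqF.
    by rewrite gtr_pMl.
  have [_ Se _ SLe] := pLe; have [_ _ _ SL] := pL.
  split => [i|a r i a0 ar rs].
    rewrite L0 subr0 => /Se; apply: near => //.
  rewrite !mxE => ne; have r0 := ltW (le_lt_trans a0 ar).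
  (* Either [Le] moves, and a contact of [Ze] is nearly one of [Z], or only [L] moves, and [Z]
     itself is in contact. *)
  have [E|/(SLe _ _ _ a0 ar)[u [au ur ui]]] := eqVneq (Le r i 0) (Le a i 0).
    have /(SL _ _ _ a0 ar)[u [au ur ui]] : L r i 0 != L a i 0.
      by apply: contraNneq ne => ->; rewrite E.
    by exists u; split => //; exact: active_lt.
  exists u; split => //; apply: near ui; first exact: ltW (le_lt_trans a0 au).
  exact: le_trans rs.
(* No bound on [Le 0] is available yet, so it occurs on both sides of the estimate;
   [e * q2 <= 1 / 2] absorbs it and leaves a norm of at most 1. *)
have base : `|Le 0| <= M.
  have [_ Se _ _] := pLe.
  have hK : `|Le 0| <= K * `|A *m Le 0| by apply: KP Se; exact: GZe.
  pose b := e * (zb + CV * `|Le 0|).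
  have b0 : 0 < b by rewrite mulr_gt0 // ltr_pwDl // mulr_ge0.
  have : `|A *m Le 0 - A *m L 0| <= KL * b.
    apply: (KLP _ _ _ _ 0 b gene gen) => // r r0 r00.
    have -> : r = 0 by apply/eqP; rewrite eq_le r0 r00.
    exact: in_dist.
  rewrite L0 mulmx0 subr0 => hY.
  have h : `|Le 0| <= e * q3 + e * q2 * `|Le 0|.
    apply: le_trans hK _; apply: le_trans (ler_wpM2l (ltW K0) hY) _.
    have -> : K * (KL * b) = e * q3 + e * (K * KL * CV) * `|Le 0|.
      by rewrite /b /q3; ring.
    rewrite lerD2l ler_wpM2r // ler_wpM2l ?(ltW e0) // /q2 ler_wpM2l //.
      by rewrite mulr_ge0 // ltW.
    by rewrite lerDl.
  have h2 : e * q2 * `|Le 0| <= 1 / 2 * `|Le 0| by rewrite ler_wpM2r.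
  lra.
have bound s : 0 <= s -> s <= t -> `|Le s - L s| <= C * e -> `|Le s| <= M - 1 / 2.
  move=> s0 st h; have -> : Le s = (Le s - L s) + L s by rewrite subrK.
  rewrite (le_trans (ler_normD _ _)) //; have := LM s s0 st.
  by rewrite (mulrC C) in h; lra.
move=> s s0 st; apply: (claim s) => // r r0 rs.
apply: (cont_path_bootstrap cLe base _ r0 (le_trans rs st)) => u u0 ut LeM.
by apply: bound => //; exact: claim.
Qed.

End PerturbedPush.

(** * Derivative along perturbed reflection directions *)

Theorem theorem3p16 (R : realType) (J N : nat) (D : sp_data R J N)
    (X Z Y : R -> 'cV[R]_J) (L : R -> 'cV[R]_N)
    (v : 'I_N -> 'cV[R]_J) (zeta : R -> 'cV[R]_J)
    (eps0 : R) (T : \bar R)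
    (hD : sp_data_wf D)
    (hpert : perturbation_condition D)
    (hX : cont_path X) (hX0 : polyhedron D (X 0))
    (hZY : solves_SP D X Z Y)
    (hL : is_pushing_process D Z Y L)
    (hv : tangential D v)
    (hzeta : cont_path zeta)
    (heps0 : perturbation_radius D v eps0)
    (hT : (0 < T)%E) :
  let V := matrix_of_cols v in
  let psi := fun s : R => zeta s + V *m L s in
  dir_deriv_exists_on (skorokhod_map D) X psi T ->
  forall t : R, 0 <= t -> (t%:E < T)%E ->
    eps^-1 *: (skorokhod_map (perturb D v eps) (fun s => X s + eps *: zeta s) t
               - skorokhod_map D X t) @[eps --> 0^'+]
      --> dir_deriv (skorokhod_map D) X psi t.
Proof.
move=> V psi exd t t0 tT.
(* The radius condition at [eps = 0] concerns [D] itself. *)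
have [setB proj li] : [/\ set_B_condition D, projection_condition D & lin_indep_condition D].
  by have [eps00 /(_ 0 (lexx _) eps00)] := heps0; rewrite perturb0.
have [_ cZ _ _ ZP] := hZY.
have GZ s : 0 <= s -> polyhedron D (Z s) by move=> /ZP[].
have [[cL _] L0 YE Lf] := hL.
have pL : pushes D Z L.
  split.
  - by move=> i; rewrite L0 mxE.
  - by move=> i; rewrite L0 mxE eqxx.
  - by move=> s u i s0 su; have [/(_ s u s0 su)] := Lf i.
  - move=> s u i s0 su ne; have [Lm cf] := Lf i.
    by apply: (charges_support hD cZ GZ cf s0 su ne); apply: Lm => //; exact: ltW.
have ZE s : 0 <= s -> Z s = X s + refl_mx D *m L s.
  by move=> s0; have [-> _ _] := ZP s s0; rewrite YE.
have sol := pushes_solves hD hX cL ZE GZ pL.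
have [C [e1 [C0 e10 close]]] :=
  perturbed_push_close hD hv setB li hX L0 sol pL hzeta t0.
have [KL KL0 KLP] := skorokhod_lipschitz hD setB.
have [CV CV0 CVP] := mulmx_norm_bound V.
pose k := (1 + KL) * (CV * C + 1).
have k0 : 0 < k.
  by rewrite mulr_gt0 //; [rewrite addr_gt0|rewrite ltr_wpDl // mulr_ge0 // ltW].
have cpsi : cont_path psi by apply: cont_pathD => //; exact: cont_path_mulmx.
(* Both outputs solve the unperturbed problem, for inputs that differ by [e] times the image under
   [V] of [L - Le]; by [close] this is of order [e * e]. *)
have key e : 0 < e -> e < e1 -> e < eps0 ->
    `|skorokhod_map D (fun s => X s + e *: psi s) t -
      skorokhod_map (perturb D v e) (fun s => X s + e *: zeta s) t| <= k * (e * e).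
  move=> e0 ee1 eeps.
  have [_ /(_ e (ltW e0) eeps)[setBe proje lie]] := heps0.
  have wfe := perturb_wf e hD hv.
  have cXe : cont_path (fun s => X s + e *: zeta s).
    by apply: cont_pathD => //; exact: cont_pathZ.
  have cXp : cont_path (fun s => X s + e *: psi s).
    by apply: cont_pathD => //; exact: cont_pathZ.
  (* Solutions have to be produced for both inputs before the values of [skorokhod_map] can be
     identified. *)
  have [Le [cLe Ge pLe]] := skorokhod_exists wfe setBe proje lie cXe.
  have [Lp [cLp Gp pLp]] := skorokhod_exists hD setB proj li cXp.
  have solp := pushes_solves hD cXp cLp (fun _ _ => erefl) Gp pLp.
  have [sole sole'] := perturb_solves hD hv hX hzeta cLe Ge pLe.
  rewrite (skorokhod_mapE wfe setBe sole t0) (skorokhod_mapE hD setB solp t0).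
  have -> : X t + e *: zeta t + refl_mx (perturb D v e) *m Le t =
      X t + e *: (zeta t + V *m Le t) + refl_mx D *m Le t.
    by have [_ _ _ _ /(_ t t0)[]] := sole'.
  pose b := e * e * (CV * C + 1).
  have b0 : 0 < b by rewrite !mulr_gt0 // ltr_wpDl // mulr_ge0 // ltW.
  have dX s : 0 <= s -> s <= t ->
      `|X s + e *: psi s - (X s + e *: (zeta s + V *m Le s))| <= b.
    move=> s0 st; rewrite opprD addrACA subrr add0r -scalerBr opprD addrACA subrr add0r.
    rewrite -mulmxBr normrZ gtr0_norm // /b -mulrA ler_pM2l //.
    apply: le_trans (CVP _) _; rewrite distrC.
    have h := close e Le e0 ee1 cLe Ge pLe s s0 st.
    have := ler_wpM2l CV0 h; nra.
  have dY := KLP _ _ _ _ t b (solves_gen_sol hD solp) (solves_gen_sol hD sole') b0 dX t t0 (lexx _).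
  rewrite opprD addrACA (le_trans (ler_normD _ _)) //.
  have -> : k * (e * e) = b + KL * b by rewrite /k /b; ring.
  by rewrite lerD // dX.
apply/cvgrPdist_lt => e e0.
have e20 : 0 < e / 2 by rewrite divr_gt0.
have /cvgrPdist_lt/(_ _ e20) dq := exd t t0 tT.
near=> d.
have d0 : 0 < d by near: d; exact: nbhs_right_gt.
have de1 : d < e1 by near: d; exact: nbhs_right_lt.
have deps : d < eps0 by near: d; apply: nbhs_right_lt; have [] := heps0.
(* After division by [d] the error in [key] is [k * d], now below [e / 2]. *)
have dk : d < e / 2 / k by near: d; apply: nbhs_right_lt; rewrite divr_gt0.
rewrite (le_lt_trans (ler_distD (diff_quotient (skorokhod_map D) X psi t d) _ _)) //.
rewrite [e]splitr; apply: ltrD; first by near: d.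
rewrite /diff_quotient -scalerBr opprB addrA subrK normrZ gtr0_norm ?invr_gt0 //.
apply: le_lt_trans (ler_wpM2l _ (key d d0 de1 deps)) _; first by rewrite invr_ge0 ltW.
by rewrite mulrCA mulKf ?gt_eqF // mulrC -ltr_pdivlMr.
Unshelve. all: by end_near. Qed.
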